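(* For all $k\geq 2$, $$\sum_{n\geq0}J^e_{2134\cdots k;1}(n)\,x^n=(1-x^2)\sum_{j=2}^{k-1}\frac{x^{k+2-j}R^e_j(x^2)\prod_{i=j+1}^{k}R_i(-x^2)}{U_{j+1}\left(\frac{1}{2x}\right)}.$$
   Context: $2134\cdots k$ denotes the permutation $(2,1,3,4,\dots,k)$ (for $k=2$ it is $21$). An occurrence of a pattern $\tau\in\mathfrak{S}_m$ in $\pi\in\mathfrak{S}_n$ is an index set $i_1<\dots<i_m$ with $\pi_{i_1}\cdots\pi_{i_m}$ order-isomorphic to $\tau$. $J^e_{\tau;r}(n)$ is the number of even involutions $\pi\in\mathfrak{S}_n$ ($\pi=\pi^{-1}$ with an even number of inversions, pairs $i<j$ with $\pi_i>\pi_j$) containing $132$ exactly once and $\tau$ exactly $r$ times. $U_r$ is the Chebyshev polynomial of the second kind ($U_0=1$, $U_1(t)=2t$, $U_r(t)=2tU_{r-1}(t)-U_{r-2}(t)$). For $k\geq1$, $R_k(x)=\dfrac{U_{k-1}\left(\frac{1}{2\sqrt{x}}\right)}{\sqrt{x}\,U_k\left(\frac{1}{2\sqrt{x}}\right)}$ (rational in $x$; $R_1=1$, $R_k=1/(1-xR_{k-1})$), and $R^e_k(x)=\tfrac12(R_k(x)+R_k(-x))$. An empty sum is $0$. *)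

(* Defs.v *)
From HB Require Import structures.
From mathcomp Require Import all_boot all_order all_fingroup all_algebra all_field.
From mathcomp Require Import classical_sets.
From mathcomp Require Import ring.

Set Implicit Arguments.
Unset Strict Implicit.
Unset Printing Implicit Defensive.

Import GRing.Theory.
Local Open Scope ring_scope.

(* Patterns are words in one-line notation.  An occurrence, i.e. an index set
   i_1 < ... < i_m, is encoded by the increasing map a |-> i_a. *)
Definition occurrence (tau : seq nat) (n : nat) (s : 'S_n)
    (f : {ffun 'I_(size tau) -> 'I_n}) : bool :=
  [forall a : 'I_(size tau), forall b : 'I_(size tau), (a < b)%N ==>
    (f a < f b)%N &&
    ((s (f a) < s (f b))%N == (nth 0%N tau a < nth 0%N tau b)%N)].

Arguments occurrence tau {n} s f.

Definition occ (tau : seq nat) (n : nat) (s : 'S_n) : nat :=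
  #|[set f | occurrence tau s f]|.

Definition inversions (n : nat) (s : 'S_n) : nat :=
  #|[set p : 'I_n * 'I_n | (p.1 < p.2)%N && (s p.2 < s p.1)%N]|.

Definition pat132 : seq nat := [:: 1; 3; 2]%N.

Definition pat2134 (k : nat) : seq nat := [:: 2, 1 & iota 3 (k - 2)]%N.

Definition Je (tau : seq nat) (r n : nat) : nat :=
  #|[set s : 'S_n | [&& s == (s^-1)%g, ~~ odd (inversions s),
                        occ pat132 s == 1%N & occ tau s == r]]|.

Fixpoint chebU (A : nzRingType) (r : nat) : {poly A} :=
  if r is r1.+1 then
    if r1 is r2.+1 then 2 *: 'X * chebU A r1 - chebU A r2 else 2 *: 'X
  else 1.

(* Some square root of [z], or 0 if [z] is not a square. *)
Definition some_sqrt (L : fieldType) (z : L) : L :=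
  xget 0 [set s : L | s ^+ 2 = z]%classic.

(* R_k evaluated at a square [z]; the choice of the root is irrelevant
   (lemma [ratR_sqr]). *)
Definition ratR (L : fieldType) (k : nat) (z : L) : L :=
  (chebU L k.-1).[1 / (2 * some_sqrt z)] /
  (some_sqrt z * (chebU L k).[1 / (2 * some_sqrt z)]).

Definition ratRe (L : fieldType) (k : nat) (z : L) : L :=
  1 / 2 * (ratR k z + ratR k (- z)).

(* Rational functions over the algebraic numbers: the scalars contain 'i, so
   that both x^2 and -x^2 are squares, of x and 'i * x respectively. *)
Notation ratfun := {fraction {poly algC}}.

Definition xvar : ratfun := tofrac 'X.

(* The formal power series \sum_n a_n x^n equals the rational function [F]:
   F = P / Q with Q(0) <> 0 and (\sum_n a_n x^n) * Q = P. *)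
Definition gf_eq (a : nat -> nat) (F : ratfun) : Prop :=
  exists P Q : {poly algC},
    [/\ Q`_0 != 0, F = tofrac P / tofrac Q &
        forall n : nat, \sum_(i < n.+1) (a i)%:R * Q`_(n - i) = P`_n].

Lemma some_sqrtP (L : fieldType) (s : L) : some_sqrt (s ^+ 2) ^+ 2 = s ^+ 2.
Proof. exact: (@xgetPex _ 0 [set t : L | t ^+ 2 = s ^+ 2]%classic (ex_intro _ s erefl)). Qed.

Lemma chebU_rec (L : fieldType) (k : nat) (t : L) :
  (chebU L k.+2).[t] = 2 * t * (chebU L k.+1).[t] - (chebU L k).[t].
Proof. by rewrite [chebU L k.+2]/= -/(chebU L k.+1) !hornerE. Qed.

Lemma chebUN (L : fieldType) (k : nat) (t : L) :
  (chebU L k).[- t] = (-1) ^+ k * (chebU L k).[t].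
Proof.
suff: (chebU L k).[- t] = (-1) ^+ k * (chebU L k).[t] /\
  (chebU L k.+1).[- t] = (-1) ^+ k.+1 * (chebU L k.+1).[t] by case.
elim: k => [|k [IH0 IH1]]; first by split; rewrite /= ?expr1 !(hornerC, hornerZ, hornerX); ring.
by split=> //; rewrite !chebU_rec IH0 IH1 !exprS; ring.
Qed.

Lemma ratR_sqr (L : fieldType) (k : nat) (s : L) : (0 < k)%N ->
  ratR k (s ^+ 2) =
  (chebU L k.-1).[1 / (2 * s)] / (s * (chebU L k).[1 / (2 * s)]).
Proof.
case: k => // k _; have /eqP := some_sqrtP s; rewrite /ratR.
rewrite eqf_sqr => /orP[] /eqP -> //.
rewrite [k.+1.-1]/=.
rewrite mulrN invrN mulrN !chebUN exprS.
set e := (-1) ^+ k; set a := _.[_]; set b := (chebU L k.+1).[_].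
have -> : - s * (-1 * e * b) = e * (s * b) by ring.
by rewrite -mulf_div divff ?mul1r // expf_neq0 // oppr_eq0 oner_neq0.
Qed.

Lemma ratR1 (L : fieldType) (s : L) :
  2 != 0 :> L -> s != 0 -> ratR 1 (s ^+ 2) = 1.
Proof.
move=> n2 ns; rewrite ratR_sqr //= hornerC hornerZ hornerX.
by field; rewrite ?oner_neq0 ?n2 ?ns.
Qed.

Lemma ratR_rec (L : fieldType) (k : nat) (s : L) :
  2 != 0 :> L -> s != 0 -> (0 < k)%N -> (chebU L k).[1 / (2 * s)] != 0 ->
  ratR k.+1 (s ^+ 2) = 1 / (1 - s ^+ 2 * ratR k (s ^+ 2)).
Proof.
case: k => // k n2 ns _ nU; rewrite !ratR_sqr // chebU_rec [k.+2.-1]/= [k.+1.-1]/=.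
set u := (chebU L k.+1).[_] in nU *; set v := (chebU L k).[_].
have -> : 2 * (1 / (2 * s)) * u - v = s^-1 * (u - s * v) by field; rewrite ?oner_neq0 ?n2 ?ns.
have -> : 1 - s ^+ 2 * (v / (s * u)) = (u - s * v) / u by field; rewrite ?oner_neq0 ?n2 ?ns ?nU.
by rewrite mulrA divff // mul1r div1r invf_div.
Qed.

(* Main.v *)
(* Let [w] be an involution containing 132 exactly once, with maximum [N] at
   position [j].  If [j = N], delete [N].  Otherwise either every entry before [N]
   exceeds every entry after it, and then symmetry forces
   [w = b' N d' b^-1 j] for shifted copies [b'], [d'] of a 132-avoiding permutation
   [b] and of an involution [d] containing 132 once; or there is a crossing, in
   which case the only fixed point of [w] has nothing south-west of it.
   Transposition acts on the occurrences of 2134...k in [w], so that their number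
   has the parity of the number of occurrences symmetric about the diagonal; the
   last entry of such an occurrence is a fixed point with something south-west of
   it.  Hence the crossing case does not contribute.

   Writing k = e + 2, let C_e be the generating function of the permutations
   avoiding 132 and 2134...k, and A_e that of the involutions containing each
   pattern once, those of length k + 1 + 2m being counted by y^m (other lengths do
   not occur; for k = 2 one also requires that 213 be avoided).  Then
   C_(e+1) = 1 + y C_e C_(e+1) and A_(e+1) = A_e + y C_e A_(e+1), whence
   A_e(y) = (1 - y) / P_k(y) with P_k(x^2) = x^k U_k(1/(2x)).  The same recursion
   determines the sign from the length, so that the even involutions are the odd
   part of A_e.  Since P_(j+1)(-y)/P_(j+1)(y) - P_j(-y)/P_j(y) is the j-th summand
   of the claim up to a common factor, the sum telescopes to that odd part. *)

Require Import Defs.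
From mathcomp Require Import all_boot all_order all_fingroup all_algebra all_field.
From mathcomp Require Import zify ring.

Set Implicit Arguments.
Unset Strict Implicit.
Unset Printing Implicit Defensive.

(** * Pattern counts of planar point sets *)

(** Points are pairs (position, value), so that [nw p q] is an inversion. With lists of points,
    transposition is a map and restriction to a quadrant is a filter. *)
Definition sw (p q : nat * nat) : bool := (p.1 < q.1) && (p.2 < q.2).
Definition nw (p q : nat * nat) : bool := (p.1 < q.1) && (q.2 < p.2).

Definition below (p : nat * nat) P := [seq q <- P | sw q p].
Definition above (p : nat * nat) P := [seq q <- P | sw p q].

Definition ninv (P : seq (nat * nat)) : nat := \sum_(p <- P) count (nw p) P.

(* [n213 e] counts the occurrences of 2134...(e+2): the last entry of such an
   occurrence is north-east of all the others. *)
Fixpoint n213 (e : nat) (P : seq (nat * nat)) : nat :=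
  if e is e'.+1 then \sum_(p <- P) n213 e' (below p P) else ninv P.

(** The entry playing 1 is south-west of the other two, which form an inversion. *)
Definition n132 (P : seq (nat * nat)) : nat := \sum_(p <- P) ninv (above p P).

Lemma ninv_perm P Q : perm_eq P Q -> ninv P = ninv Q.
Proof.
move=> PQ; rewrite /ninv (perm_big _ PQ) /=.
by apply: eq_bigr => p _; apply/seq.permP.
Qed.

Lemma n213_perm e P Q : perm_eq P Q -> n213 e P = n213 e Q.
Proof.
elim: e P Q => [|e IH] P Q PQ /=; first exact: ninv_perm.
by rewrite (perm_big _ PQ) /=; apply: eq_bigr => p _; apply/IH/perm_filter.
Qed.

Lemma n132_perm P Q : perm_eq P Q -> n132 P = n132 Q.
Proof.
move=> PQ; rewrite /n132 (perm_big _ PQ) /=.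
by apply: eq_bigr => p _; apply/ninv_perm/perm_filter.
Qed.

(** * Invariance under translation and transposition *)

Section Map.
Variables (f : nat * nat -> nat * nat).
Hypothesis f_sw : forall p q, sw (f p) (f q) = sw p q.
Hypothesis f_ninv : forall P, ninv (map f P) = ninv P.

(** Transposition reverses [nw], so the hypothesis on inversions concerns only their number. *)
Lemma n213_map e P : n213 e (map f P) = n213 e P.
Proof.
elim: e P => [|e IH] P //=; rewrite big_map; apply: eq_bigr => p _.
by rewrite -[RHS]IH /below filter_map; congr (n213 _ (map _ _)); apply: eq_filter => q /=.
Qed.

Lemma n132_map P : n132 (map f P) = n132 P.
Proof.
rewrite /n132 big_map; apply: eq_bigr => p _.
by rewrite -[RHS]f_ninv /above filter_map; congr (ninv (map _ _)); apply: eq_filter => q /=.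
Qed.
End Map.

Definition shift a b (p : nat * nat) := (a + p.1, b + p.2).

Lemma sw_shift a b p q : sw (shift a b p) (shift a b q) = sw p q.
Proof. by rewrite /sw /= !ltn_add2l. Qed.

Lemma ninv_shift a b P : ninv (map (shift a b) P) = ninv P.
Proof.
rewrite /ninv big_map; apply: eq_bigr => p _; rewrite count_map.
by apply: eq_count => q /=; rewrite /nw /= !ltn_add2l.
Qed.

Definition swap (p : nat * nat) := (p.2, p.1).

Lemma sw_swap p q : sw (swap p) (swap q) = sw p q.
Proof. by rewrite /sw andbC. Qed.

Lemma ninv_swap P : ninv (map swap P) = ninv P.
Proof.
rewrite /ninv big_map.
under eq_bigr => p _ do rewrite count_map -sum1_count big_mkcond.
under [RHS]eq_bigr => p _ do rewrite -sum1_count big_mkcond.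
rewrite exchange_big /=; apply: eq_bigr => p _; apply: eq_bigr => q _.
by rewrite /nw /= andbC.
Qed.

Definition n213_shift e a b P := n213_map (sw_shift a b) (ninv_shift a b) e P.
Definition n132_shift a b P := n132_map (sw_shift a b) (ninv_shift a b) P.
Definition n213_swap e P := n213_map sw_swap ninv_swap e P.
Definition n132_swap P := n132_map sw_swap ninv_swap P.

Lemma filter_in0 (T : eqType) (a : pred T) s :
  (forall x, x \in s -> ~~ a x) -> filter a s = [::].
Proof.
move=> h; apply/eqP; rewrite -size_eq0 size_filter eqn0Ngt -has_count.
by apply/hasPn.
Qed.

(** * Skew sums and appended maxima *)

Section Cat.
Variables P Q : seq (nat * nat).
Hypothesis PQ : forall p q, p \in P -> q \in Q -> nw p q.

Lemma ninv_cat : ninv (P ++ Q) = ninv P + ninv Q + size P * size Q.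
Proof.
rewrite {1}/ninv big_cat /=.
have -> : \sum_(p <- P) count (nw p) (P ++ Q) = ninv P + size P * size Q.
  have -> : size P * size Q = \sum_(p <- P) size Q.
    by rewrite big_const_seq count_predT iter_addn addn0 mulnC.
  rewrite -big_split /=; apply: eq_big_seq => p pP; rewrite count_cat; congr (_ + _).
  by apply/eqP; rewrite -all_count; apply/allP => q; apply: PQ.
have -> : \sum_(p <- Q) count (nw p) (P ++ Q) = ninv Q.
  apply: eq_big_seq => q qQ; rewrite count_cat -size_filter filter_in0 // => p pP.
  by have := PQ pP qQ; rewrite /nw; lia.
lia.
Qed.

(** From length 3 on, the last entry of the pattern is north-east of all others, so an occurrence
    cannot meet both [P] and [Q]; for 21 it can. *)
Lemma n213S_cat e : n213 e.+1 (P ++ Q) = n213 e.+1 P + n213 e.+1 Q.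
Proof.
rewrite /= big_cat /=; congr (_ + _); apply: eq_big_seq => p pP.
  rewrite /below filter_cat [X in _ ++ X]filter_in0 ?cats0 // => q qQ.
  by have := PQ pP qQ; rewrite /nw /sw; lia.
rewrite /below filter_cat [X in X ++ _]filter_in0 // => q qQ.
by have := PQ qQ pP; rewrite /nw /sw; lia.
Qed.

Lemma n132_cat : n132 (P ++ Q) = n132 P + n132 Q.
Proof.
rewrite /n132 big_cat /=; congr (_ + _); apply: eq_big_seq => p pP.
  rewrite /above filter_cat [X in _ ++ X]filter_in0 ?cats0 // => q qQ.
  by have := PQ pP qQ; rewrite /nw /sw; lia.
rewrite /above filter_cat [X in X ++ _]filter_in0 // => q qQ.
by have := PQ qQ pP; rewrite /nw /sw; lia.
Qed.
End Cat.

Section Max.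
Variables (P : seq (nat * nat)) (x : nat * nat).
Hypothesis Px : forall p, p \in P -> sw p x.

Lemma ninv_max : ninv (rcons P x) = ninv P.
Proof.
rewrite /ninv -cats1 big_cat big_seq1 /= count_cat /=.
rewrite -size_filter filter_in0 => [|p /Px]; last by rewrite /nw /sw; lia.
rewrite /= {2}/nw ltnn /= !addn0; apply: eq_big_seq => p /Px.
by rewrite count_cat /= /sw /nw; lia.
Qed.

Lemma below_max p : p \in P -> below p (rcons P x) = below p P.
Proof. by move=> /Px; rewrite /below filter_rcons /sw; case: ifP => //; lia. Qed.

(** Being north-east of everything, [x] can only be the last entry of an occurrence; the rest is an
    occurrence of the next shorter pattern in [P]. *)
Lemma n213S_max e : n213 e.+1 (rcons P x) = n213 e.+1 P + n213 e P.
Proof.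
rewrite /= -cats1 big_cat big_seq1 /= cats1; congr (_ + n213 e _).
  by apply: eq_big_seq => p pP; rewrite below_max.
rewrite /below filter_rcons {1}/sw ltnn /=.
by apply/all_filterP/allP => p; apply: Px.
Qed.

End Max.

Lemma n132_max P x : (forall p, p \in P -> sw p x) -> n132 (rcons P x) = n132 P.
Proof.
move=> Px; rewrite /n132 -cats1 big_cat big_seq1 /= cats1.
rewrite [above x _]filter_in0 => [|p]; last first.
  by rewrite mem_rcons inE => /predU1P[->|/Px]; rewrite /sw; lia.
rewrite {2}/ninv big_nil addn0; apply: eq_big_seq => p pP.
rewrite /above filter_rcons Px // ninv_max // => q.
by rewrite mem_filter => /andP[_ /Px].
Qed.

Lemma ninv_filter a P : ninv (filter a P) <= ninv P.
Proof.
rewrite /ninv big_filter big_mkcond /=; apply: leq_sum => p _.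
by case: ifP => // _; rewrite count_filter; apply: sub_count => q /= /andP[].
Qed.

Lemma n213_filter e a P : n213 e (filter a P) <= n213 e P.
Proof.
elim: e P => [|e IH] P /=; first exact: ninv_filter.
rewrite big_filter big_mkcond /=; apply: leq_sum => p _.
case: ifP => // _; rewrite /below -filter_predI.
by rewrite (eq_filter (a2 := predI a (sw^~ p))) ?filter_predI // => q /=; rewrite andbC.
Qed.

Lemma sum_seq_gt0 (T : eqType) (s : seq T) (F : T -> nat) :
  0 < \sum_(x <- s) F x -> exists2 x, x \in s & 0 < F x.
Proof.
elim: s => [|y s IH]; first by rewrite big_nil.
rewrite big_cons addn_gt0 => /orP[Fy|/IH[x xs Fx]].
  by exists y; rewrite ?mem_head.
by exists x; rewrite // inE xs orbT.
Qed.

Lemma leq_sum_seq1 (T : eqType) (s : seq T) (F : T -> nat) x :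
  x \in s -> F x <= \sum_(y <- s) F y.
Proof. by move=> xs; rewrite (big_rem x) //= leq_addr. Qed.

Lemma leq_sum_seq2 (T : eqType) (s : seq T) (F : T -> nat) x y :
  x \in s -> y \in s -> x != y -> F x + F y <= \sum_(z <- s) F z.
Proof.
move=> xs ys xy; rewrite (big_rem x) //= leq_add2l leq_sum_seq1 //.
by rewrite (perm_mem (perm_to_rem xs)) inE eq_sym (negPf xy) in ys.
Qed.

Lemma n213_gt0 e P : 0 < n213 e.+1 P -> 0 < n213 e P.
Proof.
by move=> /sum_seq_gt0[p _ /leq_trans]; apply; apply: n213_filter.
Qed.

(** Erasing either the last or the last but one entry of an occurrence of the longer pattern gives
    two different occurrences of the shorter one. *)
Lemma n213_gt1 e P : 0 < n213 e.+2 P -> 1 < n213 e.+1 P.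
Proof.
move=> /sum_seq_gt0[p pP /sum_seq_gt0[q]]; rewrite mem_filter => /andP[qp qP] h.
have npq : p != q by apply: contraTneq qp => ->; rewrite /sw; lia.
apply: leq_trans (leq_sum_seq2 (fun x => n213 e (below x P)) pP qP npq).
rewrite -addn1 leq_add //; apply: leq_trans h _; first exact: n213_filter.
rewrite /below -filter_predI; set s := filter _ _.
have -> : s = filter (sw^~ p) (below q P).
  by rewrite /s /below -filter_predI; apply: eq_filter => z /=; rewrite andbC.
exact: n213_filter.
Qed.

(** Sort the occurrences by their last entry [p]. Transposition matches those with [p] above the
    diagonal with those with [p] below it, so an odd total needs a [p] on the diagonal. *)
Lemma n213_parity e P : perm_eq (map swap P) P -> odd (n213 e.+1 P) ->
  exists p, [/\ p \in P, p.1 = p.2 & 0 < n213 e (below p P)].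
Proof.
move=> symP; pose F p := n213 e (below p P).
have Fswap p : F (swap p) = F p.
  rewrite /F -[RHS](n213_swap e); apply: n213_perm.
  rewrite perm_sym /below; apply/seq.permP => a; rewrite count_map !count_filter.
  rewrite -(seq.permP symP) count_map; apply: eq_count => q /=.
  by rewrite -[sw (swap q) (swap p)]/(sw _ _) sw_swap.
have split3 : n213 e.+1 P = \sum_(p <- P | p.1 == p.2) F p +
    (\sum_(p <- P | p.1 < p.2) F p + \sum_(p <- P | p.2 < p.1) F p).
  rewrite /= (bigID (fun p => p.1 == p.2)) /=; congr (_ + _).
  rewrite (bigID (fun p => p.1 < p.2)) /=; congr (_ + _); apply: eq_bigl => p; lia.
have gt_lt : \sum_(p <- P | p.2 < p.1) F p = \sum_(p <- P | p.1 < p.2) F p.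
  rewrite -(perm_big _ symP) big_map /=; apply: eq_bigr => p _; exact: Fswap.
rewrite split3 gt_lt addnn oddD odd_double addbF => /odd_gt0.
rewrite -big_filter => /sum_seq_gt0[p]; rewrite mem_filter => /andP[/eqP dp pP] Fp.
by exists p.
Qed.

(** * Permutations as words *)

Definition pts (w : seq nat) := [seq (i, nth 0 w i) | i <- iota 0 (size w)].

Lemma mem_pts i v w : ((i, v) \in pts w) = (i < size w) && (nth 0 w i == v).
Proof.
apply/mapP/andP => [[j]|[iw /eqP <-]].
  by rewrite mem_iota => /andP[_ jw] [-> ->].
by exists i; rewrite ?mem_iota.
Qed.

Lemma pts_bounds p w : p \in pts w -> p.1 < size w /\ p.2 \in w.
Proof. by case: p => i v; rewrite mem_pts => /andP[iw /eqP <-]; rewrite mem_nth. Qed.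

Lemma size_pts w : size (pts w) = size w.
Proof. by rewrite size_map size_iota. Qed.

Lemma pts_cat u v : pts (u ++ v) = pts u ++ map (shift (size u) 0) (pts v).
Proof.
rewrite /pts size_cat iotaD map_cat add0n; congr (_ ++ _).
  by apply/eq_in_map => i; rewrite mem_iota nth_cat => /andP[_ ->].
rewrite -[in LHS](addn0 (size u)) iotaDl -!map_comp; apply: eq_map => i /=.
by rewrite nth_cat ltnNge leq_addr /= addKn.
Qed.

Lemma pts_rcons u x : pts (rcons u x) = rcons (pts u) (size u, x).
Proof. by rewrite -cats1 pts_cat /= /shift /= addn0 cats1. Qed.

Lemma pts_addn c u : pts (map (addn c) u) = map (shift 0 c) (pts u).
Proof.
rewrite /pts size_map -map_comp; apply/eq_in_map => i.
by rewrite mem_iota => /andP[_ iu]; rewrite (nth_map 0).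
Qed.

Section WordCat.
Variables u v : seq nat.
Hypothesis uv : forall x y : nat, x \in u -> y \in v -> y < x.

Lemma nw_pts_cat (p q : nat * nat) : p \in pts u -> q \in map (shift (size u) 0) (pts v) -> nw p q.
Proof.
move=> /pts_bounds[pu pu2] /mapP[r /pts_bounds[_ rv] ->].
by rewrite /nw /= ltn_addr // uv.
Qed.

Lemma ninv_wcat : ninv (pts (u ++ v)) = ninv (pts u) + ninv (pts v) + size u * size v.
Proof. by rewrite pts_cat (ninv_cat nw_pts_cat) ninv_shift size_map !size_pts. Qed.

Lemma n213S_wcat e : n213 e.+1 (pts (u ++ v)) = n213 e.+1 (pts u) + n213 e.+1 (pts v).
Proof. by rewrite pts_cat (n213S_cat nw_pts_cat) n213_shift. Qed.

Lemma n132_wcat : n132 (pts (u ++ v)) = n132 (pts u) + n132 (pts v).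
Proof. by rewrite pts_cat (n132_cat nw_pts_cat) n132_shift. Qed.
End WordCat.

Section WordMax.
Variables (u : seq nat) (N : nat).
Hypothesis uN : forall x : nat, x \in u -> x < N.

Lemma sw_pts_max p : p \in pts u -> sw p (size u, N).
Proof. by move=> /pts_bounds[pu /uN pN]; rewrite /sw pu. Qed.

Lemma ninv_wmax : ninv (pts (rcons u N)) = ninv (pts u).
Proof. by rewrite pts_rcons (ninv_max sw_pts_max). Qed.

Lemma n213S_wmax e : n213 e.+1 (pts (rcons u N)) = n213 e.+1 (pts u) + n213 e (pts u).
Proof. by rewrite pts_rcons (n213S_max sw_pts_max). Qed.

Lemma n132_wmax : n132 (pts (rcons u N)) = n132 (pts u).
Proof. by rewrite pts_rcons (n132_max sw_pts_max). Qed.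
End WordMax.

Lemma ninv_waddn c u : ninv (pts (map (addn c) u)) = ninv (pts u).
Proof. by rewrite pts_addn ninv_shift. Qed.

Lemma n213_waddn e c u : n213 e (pts (map (addn c) u)) = n213 e (pts u).
Proof. by rewrite pts_addn n213_shift. Qed.

Lemma n132_waddn c u : n132 (pts (map (addn c) u)) = n132 (pts u).
Proof. by rewrite pts_addn n132_shift. Qed.

(** * Permutation words, inverses and involutions *)

Definition isperm (w : seq nat) := perm_eq w (iota 0 (size w)).

Lemma ispermE n w : (perm_eq w (iota 0 n)) = isperm w && (size w == n).
Proof.
apply/idP/andP => [h|[h /eqP <- //]].
by have := perm_size h; rewrite /isperm size_iota => ->.
Qed.

Lemma isperm_uniq w : isperm w -> uniq w.
Proof. by move=> /perm_uniq ->; apply: iota_uniq. Qed.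

Lemma isperm_mem w x : isperm w -> (x \in w) = (x < size w).
Proof. by move=> /perm_mem ->; rewrite mem_iota. Qed.

Lemma isperm_nth w i : isperm w -> i < size w -> nth 0 w i < size w.
Proof. by move=> pw iw; rewrite -isperm_mem // mem_nth. Qed.

Definition winv (w : seq nat) := [seq index v w | v <- iota 0 (size w)].

Lemma size_winv w : size (winv w) = size w.
Proof. by rewrite size_map size_iota. Qed.

Lemma nth_winv w v : v < size w -> nth 0 (winv w) v = index v w.
Proof. by move=> vw; rewrite (nth_map 0) ?size_iota // nth_iota. Qed.

Lemma pts_winv w : isperm w -> perm_eq (pts (winv w)) (map swap (pts w)).
Proof.
move=> pw.
have -> : pts (winv w) = [seq (v, index v w) | v <- iota 0 (size w)].
  by rewrite /pts size_winv; apply/eq_in_map => v; rewrite mem_iota => /andP[_ vw]; rewrite nth_winv.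
have -> : map swap (pts w) = [seq (v, index v w) | v <- w].
  transitivity [seq (v, index v w) | v <- mkseq (nth 0 w) (size w)]; last by rewrite mkseq_nth.
  rewrite /mkseq -!map_comp; apply/eq_in_map => i.
  rewrite mem_iota => /andP[_ iw] /=; rewrite /swap /= index_uniq ?isperm_uniq //.
by apply: perm_map; rewrite perm_sym.
Qed.

Lemma isperm_winv w : isperm w -> isperm (winv w).
Proof.
move=> pw; rewrite /isperm size_winv; apply: uniq_perm => [||v].
- rewrite map_inj_in_uniq ?iota_uniq // => x y.
  rewrite !mem_iota !add0n => /andP[_ xw] /andP[_ yw] exy.
  by apply: (index_inj 0) exy; rewrite isperm_mem.
- exact: iota_uniq.
rewrite mem_iota; apply/mapP/idP => [[x]|/andP[_ vw]].
  by rewrite mem_iota => /andP[_ xw] ->; rewrite index_mem isperm_mem.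
exists (nth 0 w v); first by rewrite mem_iota isperm_nth.
by rewrite index_uniq ?isperm_uniq.
Qed.

Lemma ninv_winv w : isperm w -> ninv (pts (winv w)) = ninv (pts w).
Proof. by move=> /pts_winv/ninv_perm ->; rewrite ninv_swap. Qed.

Lemma n213_winv e w : isperm w -> n213 e (pts (winv w)) = n213 e (pts w).
Proof. by move=> /pts_winv/n213_perm ->; rewrite n213_swap. Qed.

Lemma n132_winv w : isperm w -> n132 (pts (winv w)) = n132 (pts w).
Proof. by move=> /pts_winv/n132_perm ->; rewrite n132_swap. Qed.

Definition invol (w : seq nat) := all (fun i => nth 0 w (nth 0 w i) == i) (iota 0 (size w)).

Lemma involP w : reflect (forall i, i < size w -> nth 0 w (nth 0 w i) = i) (invol w).
Proof.
apply: (iffP allP) => h i; first by move=> iw; apply/eqP/h; rewrite mem_iota.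
by rewrite mem_iota => /andP[_ iw]; apply/eqP/h.
Qed.

Lemma invol_winv w : isperm w -> invol w -> winv w = w.
Proof.
move=> pw /involP iw; apply: (@eq_from_nth _ 0); rewrite size_winv // => i ilt.
rewrite nth_winv //; have /= := index_uniq 0 (isperm_nth pw ilt) (isperm_uniq pw).
by rewrite iw.
Qed.

Lemma involE w : isperm w -> invol w = perm_eq (map swap (pts w)) (pts w).
Proof.
move=> pw; apply/idP/idP => [iw|/perm_mem sym].
  by rewrite perm_sym -{1}(invol_winv pw iw) pts_winv.
apply/involP => i iw.
have := sym (nth 0 w i, i); rewrite (@mem_map _ _ swap _ (pts w) (i, nth 0 w i)); last first.
  by move=> [a b] [c d] [-> ->].
by rewrite !mem_pts iw eqxx => /esym/andP[_ /eqP].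
Qed.

Lemma isperm_cat_dom u v : isperm (u ++ v) ->
  (forall x y : nat, x \in u -> y \in v -> y < x) ->
  isperm v /\ exists2 u0, isperm u0 & u = map (addn (size v)) u0.
Proof.
move=> puv uv.
(* Both sides list the values of [u ++ v] in increasing order; comparing blocks shows that [v] takes
   the smallest values. *)
have : sort leq v ++ sort leq u = iota 0 (size v) ++ iota (size v) (size u).
  rewrite -iotaD; apply: (sorted_eq leq_trans anti_leq).
  - have sv : pairwise leq (sort leq v) by rewrite -(sorted_pairwise leq_trans); apply/sort_sorted/leq_total.
    have su : pairwise leq (sort leq u) by rewrite -(sorted_pairwise leq_trans); apply/sort_sorted/leq_total.
    rewrite (sorted_pairwise leq_trans) pairwise_cat sv su !andbT; apply/allrelP => x y.
    by rewrite !mem_sort => xv yu; apply/ltnW/uv.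
  - exact: iota_sorted.
  - apply: (@perm_trans _ (v ++ u)); first by apply: perm_cat; rewrite perm_sort.
    by rewrite perm_catC addnC -size_cat.
move=> /eqP; rewrite eqseq_cat ?size_sort ?size_iota // => /andP[/eqP sv /eqP su].
split; first by rewrite /isperm -[X in perm_eq _ X]sv perm_sym perm_sort.
have pu : perm_eq u (iota (size v) (size u)) by rewrite -[X in perm_eq _ X]su perm_sym perm_sort.
exists (map (subn^~ (size v)) u); last first.
  rewrite -map_comp -[LHS]map_id; apply/eq_in_map => x.
  by rewrite (perm_mem pu) mem_iota /= => /andP[h _]; rewrite subnKC.
rewrite /isperm size_map; apply: perm_trans (perm_map (subn^~ (size v)) pu) _.
rewrite -[X in iota X _]addn0 iotaDl -map_comp.
by rewrite (eq_map (g := id)) ?map_id // => x /=; rewrite addKn.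
Qed.

Lemma isperm_cat_addn u v : isperm u -> isperm v -> isperm (map (addn (size v)) u ++ v).
Proof.
move=> pu pv; rewrite /isperm size_cat size_map perm_catC addnC iotaD perm_cat //.
rewrite add0n -[X in iota X _]addn0 iotaDl; exact: perm_map.
Qed.

(** * Uniqueness of occurrences *)

Lemma count_le1_inj (T : eqType) (a : pred T) (s : seq T) (x y : T) :
  count a s <= 1 -> x \in s -> y \in s -> a x -> a y -> x = y.
Proof.
rewrite -sum1_count big_mkcond => s1 xs ys ax ay; apply/eqP; apply: contraLR s1 => nxy.
rewrite -ltnNge; apply: leq_trans (leq_sum_seq2 (fun z => if a z then 1 else 0) xs ys nxy).
by rewrite ax ay.
Qed.

Lemma sum_le1_inj (T : eqType) (F : T -> nat) (s : seq T) (x y : T) :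
  \sum_(z <- s) F z <= 1 -> x \in s -> y \in s -> 0 < F x -> 0 < F y -> x = y.
Proof.
move=> s1 xs ys Fx Fy; apply/eqP; apply: contraLR s1 => nxy.
rewrite -ltnNge; apply: leq_trans (leq_sum_seq2 F xs ys nxy).
by rewrite -[2]/(1 + 1) leq_add.
Qed.

Lemma ninv_gt0 P : reflect (exists q r, [/\ q \in P, r \in P & nw q r]) (0 < ninv P).
Proof.
apply: (iffP idP) => [/sum_seq_gt0[q qP]|[q [r [qP rP qr]]]].
  by rewrite -has_count => /hasP[r rP qr]; exists q, r.
apply: leq_trans (leq_sum_seq1 (fun q => count (nw q) P) qP).
by rewrite -has_count; apply/hasP; exists r.
Qed.

Lemma ninv_le1_inj P q r q' r' : ninv P <= 1 ->
  q \in P -> r \in P -> nw q r -> q' \in P -> r' \in P -> nw q' r' -> q = q' /\ r = r'.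
Proof.
move=> P1 qP rP qr qP' rP' qr'.
have eq : q = q'.
  by apply: sum_le1_inj P1 _ _ _ _ => //; rewrite -has_count; apply/hasP; [exists r|exists r'].
split=> //; rewrite -eq in qr'.
apply: (count_le1_inj (a := nw q)) rP rP' qr qr'; apply: leq_trans P1.
exact: (leq_sum_seq1 (fun q => count (nw q) P) qP).
Qed.

Section Occurrences.
Variable w : seq nat.
Local Notation p := (nth 0 w).

Definition occ132 i j l := [/\ i < j, j < l, l < size w, p i < p l & p l < p j].

Lemma occ132_above i j l : occ132 i j l ->
  [/\ (i, p i) \in pts w, (j, p j) \in above (i, p i) (pts w),
      (l, p l) \in above (i, p i) (pts w) & nw (j, p j) (l, p l)].
Proof.
move=> [ij jl lw il lj].
by rewrite !mem_filter !mem_pts /sw /nw /= !eqxx !andbT; split; lia.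
Qed.

Lemma n132_gt0 : reflect (exists i j l, occ132 i j l) (0 < n132 (pts w)).
Proof.
apply: (iffP idP) => [/sum_seq_gt0[q]|[i [j [l /occ132_above[iP jP lP h]]]]]; last first.
  apply: leq_trans (leq_sum_seq1 (fun q => ninv (above q (pts w))) iP).
  by apply/ninv_gt0; exists (j, p j), (l, p l).
case: q => i pi; rewrite mem_pts => /andP[iw /eqP <-] /ninv_gt0[[j pj] [[l pl] []]].
rewrite !mem_filter !mem_pts /sw /nw /= => /andP[/andP[ij pij] /andP[jw /eqP ej]].
move=> /andP[/andP[il pil] /andP[lw /eqP el]] /andP[jl plj].
by exists i, j, l; split; rewrite ?ej ?el.
Qed.

Lemma occ132_inj i j l i' j' l' : n132 (pts w) <= 1 -> occ132 i j l -> occ132 i' j' l' ->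
  [/\ i = i', j = j' & l = l'].
Proof.
move=> w1 /occ132_above[iP jP lP h] /occ132_above[iP' jP' lP' h'].
have g : 0 < ninv (above (i, p i) (pts w)) by apply/ninv_gt0; exists (j, p j), (l, p l).
have g' : 0 < ninv (above (i', p i') (pts w)) by apply/ninv_gt0; exists (j', p j'), (l', p l').
have [ei _] := sum_le1_inj w1 iP iP' g g'.
rewrite -ei in jP' lP'.
have w1' := leq_trans (leq_sum_seq1 (fun q => ninv (above q (pts w))) iP) w1.
by have [[-> _] [-> _]] := ninv_le1_inj w1' jP lP h jP' lP' h'.
Qed.

Hypotheses (pw : isperm w) (iw : invol w).

Lemma inv_nth i : i < size w -> p (p i) = i.
Proof. exact: (involP _ iw). Qed.

(* The inverse of an occurrence is an occurrence, so a unique one is its own inverse. *)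
Lemma occ132_fixed i j l : n132 (pts w) <= 1 -> occ132 i j l -> p i = i /\ p j = l.
Proof.
move=> w1 o; have [ij jl lw il lj] := o.
have jw : j < size w by lia.
have iw' : i < size w by lia.
(* Transposition exchanges the entries playing 3 and 2. *)
have o' : occ132 (p i) (p l) (p j) by split; rewrite ?inv_nth ?isperm_nth //; lia.
by have [-> _ ->] := occ132_inj w1 o' o.
Qed.

Variables (N j : nat).
Hypotheses (size_w : size w = N.+1) (jN : j < N) (pj : p j = N).

Lemma nth_le x : x <= N -> p x <= N.
Proof. by move=> xN; have := @isperm_nth w x pw; rewrite size_w; lia. Qed.

Lemma nth_swapE x y : x <= N -> p x = y -> p y = x.
Proof. by move=> xN <-; rewrite inv_nth // size_w; lia. Qed.

(* The entries split as [0, j-1), the fixed point j-1, and the rest; the first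
   part is mapped above j, so that nothing lies below the fixed point. *)
Lemma even_n213_core e i l : n132 (pts w) <= 1 ->
  i < j -> j < l -> l <= N -> p i < p l -> ~~ odd (n213 e.+1 (pts w)).
Proof.
move=> w1 ij jl lN il.
have nl : p l != N by apply/eqP => /(nth_swapE lN); have := @nth_swapE j N; lia.
have o : occ132 i j l by split; rewrite ?size_w //; have := nth_le lN; lia.
(* The 3 of this occurrence is the maximum, at position [j], so its 2 stands at position [N] and has
   value [j]. *)
have [pi] := occ132_fixed w1 o; rewrite pj => eN; rewrite -{}eN {l jl lN il nl} in o.
have pN : p N = j by apply: nth_swapE pj; lia.
have uo x y z : occ132 x y z -> [/\ x = i, y = j & z = N].
  by move=> o'; have := occ132_inj w1 o' o.
have nj x : x < N -> p x != j.
  by move=> xN; apply/eqP => /(@nth_swapE x); lia.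
have nN (x : nat) : x != j -> x <= N -> p x < N.
  move=> xj xN; have := nth_le xN; suff : p x != N by lia.
  by apply/eqP => /(nth_swapE xN); lia.
(* A value below [j] would make [x], [j], [N] a second occurrence of 132. *)
have F0 x : x < j -> x != i -> j < p x.
  move=> xj xi; have := nj x; suff : ~ p x < j by lia.
  move=> h; have /uo[] : occ132 x j N by split; lia.
  lia.
(* Such an entry would exceed [p N = j], making [i], [x], [N] a second occurrence; hence
   [i = j - 1]. *)
have F1 x : i < x -> x < j -> False.
  move=> ix xj; have h := F0 x xj; have := nN x.
  have /uo[] : occ132 i x N by split; lia.
  lia.
(* A value above [j] would make [i], [j], [x] a second occurrence, and no value lies strictly
   between [i] and [j]. *)
have F3 x : j < x -> x < N -> p x < i.
  move=> jx xN; have px : p x != i by apply/eqP => /(@nth_swapE x); lia.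
  have := F1 (p x); have := nj x xN; have := nN x; suff : ~ j < p x by lia.
  move=> h; have /uo[] : occ132 i j x by split=> //; have := nN x; lia.
  lia.
(* An odd number would yield a fixed point with something south-west of it. By the bounds above the
   fixed point is [i], but all entries before [i] lie above [j]. *)
apply/negP => /n213_parity[]; first by rewrite -involE.
move=> [x x'] [+ /= ex]; rewrite -{}ex mem_pts size_w => /andP[xN /eqP px].
move=> bel; have : 0 < size (below (x, x) (pts w)).
  by case: (below _ _) bel => //; case: e => [|e]; rewrite /= /ninv big_nil.
rewrite size_filter -has_count => /hasP[[y y']]; rewrite mem_pts => /andP[yN /eqP <-].
rewrite /sw /= => /andP[yx pyx].
have xj : x != j by apply/eqP => ej; move: px; rewrite ej pj; lia.
have xN' : x != N by apply/eqP => ej; move: px; rewrite ej pN; lia.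
have := F0 x; have := F0 y; have := F1 x; have := F3 x.
lia.
Qed.

End Occurrences.

(** * Nested involutions *)

Lemma isperm_inj w i j : isperm w -> i < size w -> j < size w ->
  nth 0 w i = nth 0 w j -> i = j.
Proof. by move=> /isperm_uniq uw iw jw /eqP; rewrite nth_uniq // => /eqP. Qed.

Section SingleInversion.
Variable w : seq nat.
Local Notation p := (nth 0 w).

(** The inversion is the one inside the occurrence of 132. A further entry before it or between its
    entries creates a second inversion or a second 132; a further entry after it creates a second
    inversion or a 213. *)
Lemma single_inversion : isperm w -> n132 (pts w) = 1 -> ninv (pts w) = 1 ->
  n213 1 (pts w) = 0 -> w = [:: 0; 2; 1].
Proof.
move=> pw w132 winv1 w213.
have /n132_gt0[i [j [l [ij jl lw il lj]]]] : 0 < n132 (pts w) by rewrite w132.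
have inv_uniq x y : x < y -> y < size w -> p y < p x -> x = j /\ y = l.
  move=> xy yw pyx; have inP z : z < size w -> (z, p z) \in pts w.
    by move=> zw; rewrite mem_pts zw /=.
  have h z t : z < t -> p t < p z -> nw (z, p z) (t, p t) by rewrite /nw /= => -> ->.
  have w1 : ninv (pts w) <= 1 by rewrite winv1.
  have xw := ltn_trans xy yw; have jw := ltn_trans jl lw.
  by have [[-> _] [-> _]] := ninv_le1_inj w1 (inP x xw) (inP y yw) (h _ _ xy pyx)
    (inP j jw) (inP l lw) (h _ _ jl lj).
have no213 x y z : x < y -> y < z -> z < size w -> p y < p x -> ~ p x < p z.
  move=> xy yz zw yx xz; suff : 0 < n213 1 (pts w) by rewrite w213.
  apply: leq_trans (leq_sum_seq1 (fun q => ninv (below q (pts w))) (_ : (z, p z) \in _)).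
    apply/ninv_gt0; exists (x, p x), (y, p y).
    rewrite !mem_filter !mem_pts /nw /sw /= !eqxx !andbT; split; lia.
  by rewrite mem_pts zw /=.
have inj x y : x < size w -> y < size w -> p x = p y -> x = y by apply: isperm_inj.
have xj x : x < j -> x = i.
  move=> xj; have := inv_uniq x l; have := inj x l.
  have := @occ132_inj w x j l i j l; rewrite w132 => h.
  have [] := ltngtP (p x) (p l); try lia.
  by move=> xl _ _; have [] // := h _ _ _ => //; split; lia.
have i0 : i = 0 by have := xj 0; lia.
have j1 : j = 1 by have := xj 1; lia.
have lN : l = (size w).-1.
  apply/eqP; apply: contraT => nl; have := inv_uniq j (size w).-1.
  by have := no213 j l (size w).-1; have := inj j (size w).-1; lia.
have l2 : l = 2.
  apply/eqP; apply: contraT => nl; have := inv_uniq j 2; have := inv_uniq 2 l.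
  by have := inj j 2; lia.
have sw3 : size w = 3 by lia.
have := isperm_nth pw (_ : 1 < _); have := isperm_nth pw (_ : 0 < _).
move: il lj; rewrite i0 j1 l2; clear -sw3.
case: w sw3 => [|a [|b [|c []]]] //= _ ac cb ha hb.
have := ha erefl; have := hb erefl => *.
by have [-> [-> ->]] : a = 0 /\ b = 2 /\ c = 1 by lia.
Qed.
End SingleInversion.

(** The skew sum of [u], followed by a new maximum, with [v]: the shape of every 132-avoiding
    permutation with its maximum at position [size u]. *)
Definition jn u v := map (addn (size v)) u ++ (size u + size v) :: v.

Section Jn.
Variables u v : seq nat.

Lemma jnE : jn u v = rcons (map (addn (size v)) u) (size u + size v) ++ v.
Proof. by rewrite cat_rcons. Qed.

Lemma size_jn : size (jn u v) = (size u + size v).+1.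
Proof. by rewrite size_cat size_map /= addnS. Qed.

Hypotheses (pu : isperm u) (pv : isperm v).

Lemma jn_dom (x y : nat) : x \in rcons (map (addn (size v)) u) (size u + size v) -> y \in v -> y < x.
Proof.
rewrite (isperm_mem y pv) mem_rcons inE => /predU1P[->|/mapP[z zu ->]]; lia.
Qed.

Lemma jn_max (x : nat) : x \in map (addn (size v)) u -> x < size u + size v.
Proof. by move=> /mapP[z]; rewrite (isperm_mem z pu) => zu ->; lia. Qed.

Lemma isperm_jn : isperm (jn u v).
Proof.
have puv := isperm_cat_addn pu pv; rewrite /isperm size_cat size_map in puv.
rewrite /isperm size_jn -addn1 iotaD /jn -cat1s perm_catCA cat1s.
by rewrite perm_sym perm_catC cat1s perm_cons perm_sym.
Qed.

Lemma ninv_jn : ninv (pts (jn u v)) = ninv (pts u) + ninv (pts v) + (size u).+1 * size v.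
Proof.
by rewrite jnE (ninv_wcat jn_dom) (ninv_wmax jn_max) ninv_waddn size_rcons size_map.
Qed.

Lemma n213S_jn e : n213 e.+1 (pts (jn u v)) =
  n213 e.+1 (pts u) + n213 e (pts u) + n213 e.+1 (pts v).
Proof. by rewrite jnE (n213S_wcat jn_dom) (n213S_wmax jn_max) !n213_waddn. Qed.

Lemma n132_jn : n132 (pts (jn u v)) = n132 (pts u) + n132 (pts v).
Proof. by rewrite jnE (n132_wcat jn_dom) (n132_wmax jn_max) n132_waddn. Qed.
End Jn.

Lemma isperm_rcons w : isperm w -> isperm (rcons w (size w)).
Proof.
by move=> pw; rewrite /isperm size_rcons -addn1 iotaD cats1 add0n -!cats1 perm_cat2r.
Qed.

Lemma isperm_lt w (x : nat) : isperm w -> x \in w -> x < size w.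
Proof. by move=> /isperm_mem ->. Qed.

(** For the whole to be an involution, the entries answering [b] and the maximum must be the inverse
    of [b] and then [size b], the position of the maximum. *)
Definition nest_tail b d := map (addn (size b).+1) d ++ rcons (winv b) (size b).

Definition nest b d := jn b (nest_tail b d).

Section Nest.
Variables b d : seq nat.
Let size_end : size (rcons (winv b) (size b)) = (size b).+1.
Proof. by rewrite size_rcons size_winv. Qed.

Lemma size_nest_tail : size (nest_tail b d) = size d + (size b).+1.
Proof. by rewrite size_cat size_map size_end. Qed.

Lemma size_nest : size (nest b d) = size d + 2 * (size b).+1.
Proof. by rewrite size_jn size_nest_tail; lia. Qed.

Hypotheses (pb : isperm b) (pd : isperm d).

Lemma isperm_end : isperm (rcons (winv b) (size b)).
Proof. by rewrite -[size b]size_winv isperm_rcons ?isperm_winv. Qed.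

Lemma isperm_nest_tail : isperm (nest_tail b d).
Proof. by rewrite /nest_tail -size_end; apply: isperm_cat_addn; rewrite ?isperm_end. Qed.

Lemma isperm_nest : isperm (nest b d).
Proof. by apply: isperm_jn; rewrite ?isperm_nest_tail. Qed.

Let tail_dom (x y : nat) :
  x \in map (addn (size b).+1) d -> y \in rcons (winv b) (size b) -> y < x.
Proof. by move=> /mapP[z _ ->] /(isperm_lt isperm_end); rewrite size_end; lia. Qed.

Let end_max (x : nat) : x \in winv b -> x < size b.
Proof. by move=> /(isperm_lt (isperm_winv pb)); rewrite size_winv. Qed.

(** Modulo 2 the inversions of [b] and of its inverse cancel, and so do the two products with
    [size d]; besides [d] there remains [(size b + 1)^2]. *)
Lemma odd_ninv_nest : odd (ninv (pts (nest b d))) = odd (ninv (pts d) + (size b).+1).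
Proof.
rewrite ninv_jn ?isperm_nest_tail // (ninv_wcat tail_dom) (ninv_wmax end_max) ninv_waddn ninv_winv //.
rewrite size_nest_tail size_map size_end !(oddD, oddM) /=.
by case: (odd (size b)); case: (odd (size d)); case: (odd (ninv (pts b))); case: (odd (ninv (pts d))).
Qed.

(** Both [b] and its inverse are followed by a larger entry and contribute equally, hence the
    doubling. *)
Lemma n213S_nest e : n213 e.+1 (pts (nest b d)) =
  (n213 e.+1 (pts b) + n213 e (pts b)).*2 + n213 e.+1 (pts d).
Proof.
rewrite n213S_jn ?isperm_nest_tail // (n213S_wcat tail_dom) (n213S_wmax end_max).
rewrite n213_waddn !n213_winv //; lia.
Qed.

Lemma n132_nest : n132 (pts (nest b d)) = (n132 (pts b)).*2 + n132 (pts d).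
Proof.
rewrite n132_jn ?isperm_nest_tail // (n132_wcat tail_dom) (n132_wmax end_max).
rewrite n132_waddn !n132_winv //; lia.
Qed.

Lemma nth_nest_left i : i < size b ->
  nth 0 (nest b d) i = (size b).+1 + size d + nth 0 b i.
Proof.
move=> ib; rewrite nth_cat size_map ib (nth_map 0) // size_nest_tail.
by rewrite [size d + _]addnC.
Qed.

Lemma nth_nest_max : nth 0 (nest b d) (size b) = (size b).+1 + size d + size b.
Proof. by rewrite nth_cat size_map ltnn subnn /= size_nest_tail; lia. Qed.

Lemma nth_nest_tail i : nth 0 (nest b d) ((size b).+1 + i) = nth 0 (nest_tail b d) i.
Proof.
rewrite nth_cat size_map ltnNge leqW ?leq_addr //= addSn -[_.+1]addn1.
by rewrite -addnA addKn addn1.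
Qed.

Lemma nth_nest_mid i : i < size d -> nth 0 (nest b d) ((size b).+1 + i) = (size b).+1 + nth 0 d i.
Proof. by move=> id; rewrite nth_nest_tail nth_cat size_map id (nth_map 0). Qed.

Lemma nth_nest_right a : a < size b ->
  nth 0 (nest b d) ((size b).+1 + size d + a) = index a b.
Proof.
move=> ab; rewrite -addnA nth_nest_tail nth_cat size_map ltnNge leq_addr /= addKn.
by rewrite nth_rcons size_winv ab nth_winv.
Qed.

Lemma nth_nest_last : nth 0 (nest b d) ((size b).+1 + size d + size b) = size b.
Proof.
rewrite -addnA nth_nest_tail nth_cat size_map ltnNge leq_addr /= addKn.
by rewrite nth_rcons size_winv ltnn eqxx.
Qed.

(** The first and the last [size b + 1] positions are exchanged whatever [b] is, so only the middle
    block matters. *)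
Lemma invol_nest : invol (nest b d) = invol d.
Proof.
apply/involP/involP => h i iw.
  have := h ((size b).+1 + i); rewrite size_nest nth_nest_mid //.
  by rewrite nth_nest_mid ?isperm_nth // => /(_ ltac:(lia)) /addnI.
move: iw; rewrite size_nest => iw.
have [ib|bi|->] := ltngtP i (size b); last by rewrite nth_nest_max nth_nest_last.
  by rewrite (nth_nest_left ib) nth_nest_right ?isperm_nth // index_uniq ?isperm_uniq.
have [id|di] := ltnP i ((size b).+1 + size d).
  have hi : i - (size b).+1 < size d by lia.
  by rewrite -(subnKC bi) nth_nest_mid // nth_nest_mid ?isperm_nth // h.
have [ai|ai|ei] := ltngtP (i - ((size b).+1 + size d)) (size b).
- rewrite -(subnKC di) nth_nest_right // nth_nest_left ?index_mem ?isperm_mem //.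
  by rewrite nth_index ?isperm_mem.
- by lia.
by rewrite -(subnKC di) ei nth_nest_last nth_nest_max.
Qed.
End Nest.

(** * Decomposition at the maximum *)

Lemma jn_decomp u v : isperm (u ++ size u + size v :: v) ->
  (forall x y : nat, x \in u -> y \in v -> y < x) ->
  isperm v /\ exists u0, [/\ isperm u0, size u0 = size u & u ++ size u + size v :: v = jn u0 v].
Proof.
set N := size u + size v => pw uv.
have puv : isperm (u ++ v).
  move: pw; rewrite /isperm !size_cat /= addnS -addn1 iotaD add0n -cat1s perm_catCA.
  by rewrite perm_sym perm_catC !cat1s perm_cons perm_sym.
have [pv [u0 pu0 eu]] := isperm_cat_dom puv uv.
split=> //; exists u0; rewrite eu size_map; split=> //.
by rewrite /jn /N eu size_map.
Qed.

Lemma split_at w N j : size w = N.+1 -> j <= N -> nth 0 w j = N ->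
  w = take j w ++ N :: drop j.+1 w.
Proof. by move=> sw jN <-; rewrite -drop_nth ?cat_take_drop // sw. Qed.

Lemma jn_at w N j : isperm w -> size w = N.+1 -> j <= N -> nth 0 w j = N ->
  (forall i l, i < j -> j < l -> l <= N -> nth 0 w l < nth 0 w i) ->
  exists u v, [/\ isperm u, isperm v, size u = j, size v = N - j & w = jn u v].
Proof.
move=> pw sw jN pj dom; have ew := split_at sw jN pj.
have sl : size (take j w) = j by rewrite size_take sw ifT //; lia.
have sr : size (drop j.+1 w) = N - j by rewrite size_drop sw.
have eN : N = size (take j w) + size (drop j.+1 w) by rewrite sl sr; lia.
have [|x y xl yr|pv [u [pu su eu]]] := @jn_decomp (take j w) (drop j.+1 w).
- by rewrite -eN -ew.
- move: xl yr => /(nthP 0)[i]; rewrite sl => ij <- /(nthP 0)[l]; rewrite sr => lN <-.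
  by rewrite nth_take // nth_drop; apply: dom; lia.
exists u, (drop j.+1 w); split=> //; first by rewrite su.
by rewrite -eu -eN -ew.
Qed.

(** Without crossings [w] splits at its maximum as [jn u v]; symmetry then identifies the end of [v]
    with the inverse of [u] followed by [j]. *)
Lemma nest_at w N j : isperm w -> invol w -> size w = N.+1 -> j < N -> nth 0 w j = N ->
  (forall i l, i < j -> j < l -> l <= N -> nth 0 w l < nth 0 w i) ->
  exists b d, [/\ isperm b, isperm d, invol d, size b = j & w = nest b d].
Proof.
move=> pw iw sw jN pj dom.
have [u [v [pu pv su sv ew]]] := jn_at pw sw (ltnW jN) pj dom.
have pp i : i <= N -> nth 0 w (nth 0 w i) = i by move=> iN; apply: (involP _ iw); rewrite sw.
have pN : nth 0 w N = j by rewrite -pj pp //; lia.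
have wl i : i < j -> nth 0 w i = N - j + nth 0 u i.
  by move=> ij; rewrite ew nth_cat size_map su ij (nth_map 0) ?su // sv.
have wr i : i < N - j -> nth 0 w (j.+1 + i) = nth 0 v i.
  move=> ij; rewrite ew nth_cat size_map su ltnNge (_ : j <= j.+1 + i) /=; last by lia.
  by rewrite (_ : j.+1 + i - j = i.+1) //; lia.
have nu i : i < j -> nth 0 u i < j by rewrite -su; apply: isperm_nth.
have nv i : i < N - j -> nth 0 v i < N - j by rewrite -sv; apply: isperm_nth.
(* The value [j] stands at position [N], hence within [v], all of whose values are below [N - j]. *)
have jj : j < N - j.
  have lt : (N - j).-1 < N - j by lia.
  have := nv _ lt; rewrite -wr // (_ : j.+1 + (N - j).-1 = N) ?pN //; lia.
pose d := N - j - j.+1.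
have ev : v = take d v ++ rcons (winv u) j.
  rewrite -[LHS](cat_take_drop d); congr (_ ++ _); apply: (@eq_from_nth _ 0).
    by rewrite size_drop sv size_rcons size_winv su /d; lia.
  rewrite size_drop sv => i id; rewrite nth_drop nth_rcons size_winv su -wr; last by lia.
  case: ltnP => ij.
    rewrite nth_winv ?su //; have iu : i \in u by rewrite isperm_mem ?su.
    have kj : index i u < j by rewrite -su index_mem.
    rewrite -(pp (index i u)); last by lia.
    by rewrite (wl _ kj) nth_index //; congr (nth 0 w _); rewrite /d; lia.
  rewrite (_ : j.+1 + (d + i) = N) ?pN; last by rewrite /d; lia.
  by rewrite ifT //; rewrite /d in id *; lia.
have sd : size (take d v) = d by rewrite size_take sv /d; case: ifP; lia.
have pv' := pv; rewrite ev in pv'.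
(* The positions up to [j] carry values at least [N - j]; by symmetry the values up to [j] stand
   only in the last [j + 1] positions. *)
have nd i : i < d -> j < nth 0 v i.
  move=> id; rewrite -wr; last by rewrite /d in id; lia.
  have lt : j.+1 + i <= N by rewrite /d in id; lia.
  have := pp _ lt; set x := nth 0 w (j.+1 + i) => ex.
  rewrite ltnNge leq_eqVlt; apply/negP => /orP[/eqP xj|xj]; move: ex.
    by rewrite xj pj; rewrite /d in id; lia.
  by rewrite (wl _ xj); rewrite /d in id; lia.
have [x y|pe [d0 pd0 ed]] := isperm_cat_dom pv'.
  move=> /(nthP 0)[i]; rewrite sd => id <- ; rewrite nth_take //.
  have := nd i id; rewrite mem_rcons inE => h /predU1P[->//|yw].
  by apply: ltn_trans h; have := isperm_lt (isperm_winv pu) yw; rewrite size_winv su.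
rewrite size_rcons size_winv su in ed.
have sd0 : size d0 = d by rewrite -sd ed size_map.
exists u, d0.
have ew' : w = nest u d0 by rewrite ew ev ed /nest /nest_tail su.
by split=> //; rewrite -(invol_nest pu pd0) -ew'.
Qed.

(** * Recursions for the numbers of permutations *)

Arguments n213 : simpl never.

(** Appending a maximum to [w] turns the count of the longer pattern into the sum of the two counts;
    the last two conditions say that this sum is 1 because of [n213 e]. *)
Definition inA e w := [&& invol w, n132 (pts w) == 1, n213 e (pts w) == 1
  & n213 e.+1 (pts w) == 0].

Definition inC e w := (n132 (pts w) == 0) && (n213 e (pts w) == 0).

Definition listA e n := [seq w <- permutations (iota 0 n) | inA e w].
Definition listC e n := [seq w <- permutations (iota 0 n) | inC e w].

Lemma mem_listA e n w : (w \in listA e n) = [&& inA e w, isperm w & size w == n].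
Proof. by rewrite mem_filter mem_permutations ispermE. Qed.

Lemma mem_listC e n w : (w \in listC e n) = [&& inC e w, isperm w & size w == n].
Proof. by rewrite mem_filter mem_permutations ispermE. Qed.

Lemma listA_uniq e n : uniq (listA e n).
Proof. by rewrite filter_uniq ?permutations_uniq. Qed.

Lemma listC_uniq e n : uniq (listC e n).
Proof. by rewrite filter_uniq ?permutations_uniq. Qed.

(** An occurrence of the longer pattern would contain two of the shorter one. *)
Lemma inAS e w : inA e.+1 w = [&& invol w, n132 (pts w) == 1 & n213 e.+1 (pts w) == 1].
Proof.
rewrite /inA; case: (invol w) => //=; case: (n132 _ == 1) => //=.
case: eqP => //= h; apply/eqP/eqP; rewrite eqn0Ngt; apply/negP => /n213_gt1.
by rewrite h.
Qed.

Lemma isperm_rconsE w N : isperm (rcons w N) -> size w = N -> isperm w.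
Proof.
by move=> + e; rewrite -{}e /isperm size_rcons -addn1 iotaD add0n -cats1 perm_cat2r.
Qed.

Lemma invol_rcons w : isperm w -> invol (rcons w (size w)) = invol w.
Proof.
move=> pw; apply/involP/involP => h i iw.
  have := h i; rewrite size_rcons !nth_rcons iw isperm_nth //; apply; exact: ltnW.
move: iw; rewrite size_rcons ltnS leq_eqVlt => /predU1P[->|iw].
  by rewrite !nth_rcons ltnn eqxx ltnn eqxx.
by rewrite (nth_rcons _ _ _ i) iw nth_rcons isperm_nth // h.
Qed.

Lemma inA_rcons e w : isperm w -> inA e.+1 (rcons w (size w)) = inA e w.
Proof.
move=> pw; have m x : x \in w -> x < size w by apply: isperm_lt.
rewrite inAS invol_rcons // (n132_wmax m) (n213S_wmax m) /inA.
have := @n213_gt0 e (pts w).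
by case: (invol w); case: (n132 (pts w) == 1) => //=; lia.
Qed.

(** The contributions of [b] are doubled, so a total of 1 leaves none to [b]; since [b] is followed
    by a maximum, it has to avoid the shorter pattern. *)
Lemma inA_nest e b d : isperm b -> isperm d ->
  inA e.+1 (nest b d) = inC e b && inA e.+1 d.
Proof.
move=> pb pd; rewrite !inAS invol_nest // n132_nest // n213S_nest // /inC.
case: (invol d); rewrite /= ?andbF //.
have gb := @n213_gt0 e (pts b).
apply/andP/and3P => [[/eqP h1 /eqP h2]|[/andP[/eqP h1 /eqP h2] /eqP h3 /eqP h4]].
  split; first (apply/andP; split); apply/eqP; lia.
by split; apply/eqP; lia.
Qed.

(** The new maximum extends every occurrence of the shorter pattern in [u], so [u] must avoid that
    one. *)
Lemma inC_jn e u v : isperm u -> isperm v -> inC e.+1 (jn u v) = inC e u && inC e.+1 v.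
Proof.
move=> pu pv; rewrite /inC n132_jn // n213S_jn //; have := @n213_gt0 e (pts u).
lia.
Qed.

Lemma size_partition (T : Type) (f : T -> nat) (s : seq T) n : all (fun x => f x < n) s ->
  size s = \sum_(i < n) size [seq x <- s | f x == i].
Proof.
elim: s => [|x s IH] /=; first by rewrite big1.
case/andP=> fx /IH ->; rewrite -add1n.
have -> : 1 = \sum_(i < n) (f x == i :> nat).
  rewrite (bigD1 (Ordinal fx)) //= eqxx big1 // => i ni.
  by case: eqP => // e; case/eqP: ni; apply: val_inj.
by rewrite -big_split; apply: eq_bigr => i _ /=; case: ifP.
Qed.

Lemma index_max_lt w N : isperm w -> size w = N.+1 -> index N w < N.+1.
Proof. by move=> pw sw; rewrite -[X in _ < X]sw index_mem isperm_mem ?sw. Qed.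

Lemma nth_index_max w N : isperm w -> size w = N.+1 -> nth 0 w (index N w) = N.
Proof. by move=> pw sw; rewrite nth_index // isperm_mem ?sw. Qed.

Lemma index_jn u v : isperm u -> isperm v -> index (size u + size v) (jn u v) = size u.
Proof.
move=> pu pv; have := isperm_uniq (isperm_jn pu pv).
have e : nth 0 (jn u v) (size u) = size u + size v.
  by rewrite nth_cat size_map ltnn subnn.
move=> un; rewrite -[X in index X]e index_uniq // size_jn; lia.
Qed.

Lemma jn_inj u v u' v' : size u = size u' -> jn u v = jn u' v' -> u = u' /\ v = v'.
Proof.
move=> su /eqP; rewrite eqseq_cat ?size_map // => /andP[/eqP eu /eqP[_ ev]].
by split=> //; rewrite ev in eu; apply: inj_map eu; apply: addnI.
Qed.

Lemma nest_inj b d b' d' : size b = size b' -> size d = size d' ->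
  nest b d = nest b' d' -> b = b' /\ d = d'.
Proof.
move=> sb sd /(jn_inj sb)[eb /eqP et]; split=> //; move: et.
rewrite eqseq_cat ?size_map // => /andP[/eqP + _].
by rewrite -eb => /inj_map; apply; apply: addnI.
Qed.

(** Avoiding 21 leaves only the identity. *)
Lemma size_listC0 n : size (listC 0 n) = 1.
Proof.
suff /perm_size : perm_eq (listC 0 n) [:: iota 0 n] by [].
apply: uniq_perm; rewrite ?listC_uniq // => w; rewrite inE mem_listC.
apply/and3P/eqP => [[/andP[_ /eqP inv0] pw /eqP <-]|->]; last first.
  rewrite /isperm !size_iota eqxx; split=> //; rewrite /inC -[n213 0 _]/(ninv _).
  elim: n => [|n IH]; first by rewrite /n132 /ninv !big_nil.
  have m x : x \in iota 0 n -> x < n by rewrite mem_iota.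
  by rewrite -addn1 iotaD cats1 (n132_wmax m) (ninv_wmax m).
apply: (sorted_eq leq_trans anti_leq) pw; last exact: iota_sorted.
rewrite (sorted_pairwise leq_trans); apply/(pairwiseP 0) => i j iw jw ij.
rewrite leqNgt; apply/negP => pij; suff : 0 < n213 0 (pts w) by rewrite inv0.
apply/ninv_gt0; exists (i, nth 0 w i), (j, nth 0 w j).
by rewrite !mem_pts !eqxx !andbT /nw /= ij.
Qed.

(** Classify by the position [i] of the maximum: in a 132-avoider all entries before it exceed all
    entries after it. *)
Lemma size_listCS e n : size (listC e.+1 n.+1) =
  \sum_(i < n.+1) size (listC e i) * size (listC e.+1 (n - i)).
Proof.
rewrite (@size_partition _ (index n) _ n.+1); last first.
  by apply/allP => w; rewrite mem_listC => /and3P[_ pw /eqP sw]; apply: index_max_lt.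
apply: eq_bigr => i _; have iN := ltn_ord i.
rewrite -(size_allpairs jn); apply: perm_size; apply: uniq_perm.
- by rewrite filter_uniq ?listC_uniq.
- apply: allpairs_uniq; rewrite ?listC_uniq // => -[u v] [u' v'].
  move=> /allpairsP[[? ?] /= [+ _ [-> _]]] /allpairsP[[? ?] /= [+ _ [-> _]]].
  rewrite !mem_listC => /and3P[_ _ /eqP s1] /and3P[_ _ /eqP s2] /jn_inj[].
    by rewrite s1.
  by move=> -> ->.
move=> w; rewrite mem_filter mem_listC; apply/andP/allpairsP => [[/eqP ei /and3P[cw pw /eqP sw]]|].
  have pi := nth_index_max pw sw; rewrite ei in pi.
  have dom x l : x < i -> i < l -> l <= n -> nth 0 w l < nth 0 w x.
    move=> xi il ln; rewrite ltnNge leq_eqVlt; apply/negP => /predU1P[exl|xl].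
      by have := isperm_inj pw _ _ exl; rewrite sw; lia.
    have /andP[/eqP c0 _] := cw; suff : 0 < n132 (pts w) by rewrite c0.
    apply/n132_gt0; exists x, i, l; split; rewrite ?sw ?pi //.
    have := @isperm_nth w l pw; have := @isperm_inj w l i pw; rewrite sw pi; lia.
  have [u [v [pu pv su sv ew]]] := jn_at pw sw iN pi dom.
  rewrite ew inC_jn // in cw; have /andP[cu cv] := cw.
  by exists (u, v); rewrite !mem_listC /= cu pu su cv pv sv !eqxx.
move=> [[u v] [/=]]; rewrite !mem_listC => /and3P[cu pu /eqP su] /and3P[cv pv /eqP sv] ->.
have suv : size u + size v = n by rewrite su sv; lia.
by rewrite inC_jn // cu cv isperm_jn // size_jn suv -{1}suv index_jn // su !eqxx.
Qed.

Lemma listA_max e N w : w \in listA e.+1 N.+1 -> index N w = N ->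
  exists2 u, u \in listA e N & w = rcons u N.
Proof.
rewrite mem_listA => /and3P[aw pw /eqP sw] ei.
have pN := nth_index_max pw sw; rewrite ei in pN.
have ew : w = rcons (take N w) N.
  by rewrite [LHS](split_at sw (leqnn N) pN) -cats1 drop_oversize // sw.
have sN : size (take N w) = N by rewrite size_take sw ltnSn.
have pt : isperm (take N w) by apply: isperm_rconsE sN; rewrite -ew.
exists (take N w) => //; rewrite mem_listA pt sN eqxx !andbT.
by rewrite -inA_rcons // sN -ew.
Qed.

Lemma size_listA_max e N :
  size [seq w <- listA e.+1 N.+1 | index N w == N] = size (listA e N).
Proof.
rewrite -[RHS](size_map (rcons^~ N)); apply: perm_size; apply: uniq_perm.
- by rewrite filter_uniq ?listA_uniq.
- by rewrite map_inj_uniq ?listA_uniq //; apply: rcons_injl.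
move=> w; rewrite mem_filter; apply/andP/mapP => [[/eqP ei wA]|].
  exact: listA_max.
move=> [u]; rewrite mem_listA => /and3P[au pu /eqP su] ->.
have aw := inA_rcons e pu; have pw := isperm_rcons pu; rewrite su in aw pw.
rewrite mem_listA aw au pw size_rcons su eqxx; split=> //.
by rewrite -cats1 index_cat isperm_mem // su ltnn /= eqxx addn0.
Qed.

(** A crossing would make the number of occurrences even, but it is 1. *)
Lemma inA_no_crossing e N w i l : inA e.+1 w -> isperm w -> size w = N.+1 ->
  index N w < N -> i < index N w -> index N w < l -> l <= N -> nth 0 w l < nth 0 w i.
Proof.
rewrite inAS => /and3P[iw /eqP w1 /eqP we] pw sw jN ij jl lN.
have pj := nth_index_max pw sw.
rewrite ltnNge leq_eqVlt; apply/negP => /predU1P[e_il|il].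
  by have := isperm_inj pw _ _ e_il; rewrite sw; lia.
have := @even_n213_core w pw iw N _ sw jN pj e i l; rewrite w1 we.
by move=> /(_ isT ij jl lN il).
Qed.

Lemma listA_nest e N w : w \in listA e.+1 N.+1 -> index N w < N ->
  exists b d, [/\ w = nest b d, b \in listC e (size b), d \in listA e.+1 (size d) & size b = index N w].
Proof.
rewrite mem_listA => /and3P[aw pw /eqP sw] jN.
have iw : invol w by move: aw; rewrite inAS => /and3P[].
have [b [d [pb pd _ sb ew]]] := nest_at pw iw sw jN (nth_index_max pw sw)
  (fun i l => @inA_no_crossing e N w i l aw pw sw jN).
have /andP[cb ad] : inC e b && inA e.+1 d by rewrite -inA_nest // -ew.
by exists b, d; split; rewrite ?mem_listC ?mem_listA ?cb ?pb ?ad ?pd ?eqxx.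
Qed.

(** A nest with [size b = j] has length [size d + 2 (j + 1)], so length [N + 1] forces [2 j < N] and
    [size d = N - 2 j - 1]. *)
Lemma size_listA_nest e N j : j < N ->
  size [seq w <- listA e.+1 N.+1 | index N w == j] =
  if j.*2 < N then size (listC e j) * size (listA e.+1 (N - j.*2.+1)) else 0.
Proof.
move=> jN; case: ifP => h; last first.
  apply/eqP; rewrite size_eq0; apply/eqP/filter_in0 => w wA; apply/eqP => ej.
  have [|b [d [ew _ _ sb]]] := listA_nest wA; first by rewrite ej.
  move: wA; rewrite mem_listA ew size_nest sb ej => /and3P[_ _ /eqP]; lia.
rewrite -(size_allpairs nest); apply: perm_size; apply: uniq_perm.
- by rewrite filter_uniq ?listA_uniq.
- apply: allpairs_uniq; rewrite ?listC_uniq ?listA_uniq // => -[u v] [u' v'].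
  move=> /allpairsP[[? ?] /= [+ + [-> ->]]] /allpairsP[[? ?] /= [+ + [-> ->]]].
  rewrite !mem_listC !mem_listA => /and3P[_ _ /eqP s1] /and3P[_ _ /eqP t1].
  move=> /and3P[_ _ /eqP s2] /and3P[_ _ /eqP t2] /nest_inj[].
  + by rewrite s1.
  + by rewrite t1.
  by move=> -> ->.
move=> w; rewrite mem_filter; apply/andP/allpairsP => [[/eqP ej wA]|].
  have [|b [d [ew bC dA sb]]] := listA_nest wA; first by rewrite ej.
  rewrite ej in sb; exists (b, d); split=> //=; first by rewrite -sb.
  suff <- : size d = N - j.*2.+1 by [].
  by move: wA; rewrite mem_listA ew size_nest sb => /and3P[_ _ /eqP]; lia.
move=> [[u v] [/=]]; rewrite mem_listC !mem_listA => /and3P[cu pu /eqP su] /and3P[av pv /eqP sv] ->.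
have pt := isperm_nest_tail pu pv.
have st : size u + size (nest_tail u v) = N by rewrite size_nest_tail su sv; lia.
rewrite inA_nest // cu av isperm_nest // size_jn st eqxx; split=> //.
by rewrite -st index_jn // su.
Qed.

Lemma size_listAS e N : size (listA e.+1 N.+1) = size (listA e N) +
  \sum_(j < N | j.*2 < N) size (listC e j) * size (listA e.+1 (N - j.*2.+1)).
Proof.
rewrite (@size_partition _ (index N) _ N.+1); last first.
  by apply/allP => w; rewrite mem_listA => /and3P[_ pw /eqP sw]; apply: index_max_lt.
rewrite big_ord_recr /= size_listA_max addnC [in RHS]big_mkcond; congr (_ + _).
by apply: eq_bigr => j _; rewrite size_listA_nest.
Qed.

Lemma listA0 w : isperm w -> inA 0 w = (w == [:: 0; 2; 1]).
Proof.
move=> pw; apply/and4P/eqP => [[_ /eqP w1 /eqP w2 /eqP w3]|->].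
  exact: single_inversion.
by split; rewrite /n132 /n213 /ninv ?unlock.
Qed.

(* Since the sign of an involution is its number of transpositions, the second
   claim means that the number of fixed points is congruent to [e + 1] modulo 4. *)
Lemma listA_parity e n w : w \in listA e n ->
  exists m, n = e + 3 + m.*2 /\ odd (ninv (pts w)) = ~~ odd m.
Proof.
elim/ltn_ind: n e w => n IH e w wA; have := wA; rewrite mem_listA => /and3P[aw pw /eqP sw].
case: e aw wA => [|e] aw wA.
  exists 0; move: aw; rewrite -sw listA0 // => /eqP ->; split=> //.
  by rewrite /ninv unlock.
case: n sw wA IH => [|N] sw wA IH; first by move: aw; rewrite (size0nil sw) inAS /n132 big_nil andbF.
have := index_max_lt pw sw; rewrite ltnS leq_eqVlt => /predU1P[ei|jN].
  have [u uA ew] := listA_max wA ei; have [m [em om]] := IH N (ltnSn N) _ _ uA.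
  exists m; rewrite em; split=> //; rewrite -om ew ninv_wmax // => x.
  by move: uA; rewrite mem_listA => /and3P[_ pu /eqP <-]; apply: isperm_lt.
have [b [d [ew bC dA sb]]] := listA_nest wA jN.
have sN : size d + 2 * (size b).+1 = N.+1 by rewrite -size_nest -ew.
have [|m [em om]] := IH (size d) _ _ _ dA; first by lia.
(* Nesting adds [2 (size b + 1)] to the length and, modulo 2, [size b + 1] to the inversions, so the
   relation persists. *)
exists (m + (size b).+1); split; first by lia.
move: bC dA; rewrite mem_listC mem_listA => /and3P[_ pb _] /and3P[_ pd _].
by rewrite ew odd_ninv_nest // oddD om oddD addNb.
Qed.

(** * From permutations of ordinals to words *)

Section Transfer.
Variables (n : nat) (s : 'S_n).

Definition compat (t : nat -> nat) m (f : {ffun 'I_m -> 'I_n}) (a b : 'I_m) : bool :=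
  (a < b) ==> (f a < f b) && ((s (f a) < s (f b)) == (t a < t b)).

(** Patterns are functions on [nat] of which the first [m] values count, and positions are confined
    to a set [I], so that entries can be removed one at a time. *)
Definition occ_in (t : nat -> nat) m (I : {set 'I_n}) : nat :=
  #|[set f : {ffun 'I_m -> 'I_n} | [forall a, f a \in I] &&
      [forall a, forall b, compat t f a b]]|.

Lemma eq_occ_in t t' m I : (forall a, a < m -> t a = t' a) -> occ_in t m I = occ_in t' m I.
Proof.
move=> tt; apply: eq_card => f; rewrite !inE; congr (_ && _).
by apply: eq_forallb => a; apply: eq_forallb => b; rewrite /compat !tt.
Qed.

Lemma occ_in0 t I : occ_in t 0 I = 1.
Proof.
transitivity #|{: {ffun 'I_0 -> 'I_n}}|; last by rewrite card_ffun !card_ord expn0.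
by apply: eq_card => f; rewrite !inE; apply/andP; split; apply/forallP => -[].
Qed.

(** Sum over the position [x] of entry [h]. Its relations to the other entries confine these to the
    [y] with [q x y], and they form an occurrence of the pattern without entry [h]. *)
Lemma occ_in_pivot t m (h : 'I_m.+1) (q : rel 'I_n) I :
  (forall (f : {ffun 'I_m.+1 -> 'I_n}) (a : 'I_m),
     compat t f h (lift h a) && compat t f (lift h a) h = q (f h) (f (lift h a))) ->
  occ_in t m.+1 I = \sum_(x in I) occ_in (t \o bump h) m [set y in I | q x y].
Proof.
move=> hq; rewrite /occ_in -sum1_card.
rewrite (partition_big (fun f : {ffun 'I_m.+1 -> 'I_n} => f h) (mem I)) /=; last first.
  by move=> f; rewrite inE => /andP[/forallP/(_ h)].
apply: eq_bigr => x xI; rewrite sum1_card.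
pose ext (g : {ffun 'I_m -> 'I_n}) :=
  [ffun a => if unlift h a is Some a' then g a' else x].
have ext_h g : ext g h = x by rewrite ffunE unlift_none.
have ext_l g a : ext g (lift h a) = g a by rewrite ffunE liftK.
have ext_inj : injective ext.
  by move=> g g' /ffunP e; apply/ffunP => a; have := e (lift h a); rewrite !ext_l.
rewrite -(card_imset _ ext_inj); apply: eq_card => f.
have compat_lift (g : {ffun 'I_m.+1 -> 'I_n}) (g' : {ffun 'I_m -> 'I_n}) a b :
    (forall c, g (lift h c) = g' c) -> compat t g (lift h a) (lift h b) = compat (t \o bump h) g' a b.
  move=> e; rewrite /compat !e /=; congr (_ ==> _).
  by rewrite /bump; case: leqP; case: leqP; lia.
apply/idP/imsetP => [|[g]].
  rewrite unfold_in /= inE => /andP[/andP[/forallP fI /forallP fc] /eqP fx].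
  exists [ffun a => f (lift h a)].
    rewrite inE; apply/andP; split; apply/forallP => a.
      rewrite ffunE inE fI -fx -hq.
      by have /forallP -> := fc h; have /forallP -> := fc (lift h a).
    apply/forallP => b; rewrite -(compat_lift f) => [|c]; last by rewrite ffunE.
    by have /forallP -> := fc (lift h a).
  apply/ffunP => a; case: (unliftP h a) => [a' ->|->]; first by rewrite ext_l ffunE.
  by rewrite ext_h.
rewrite inE => /andP[/forallP gI /forallP gc] ->.
rewrite unfold_in /= inE ext_h eqxx andbT; apply/andP; split; apply/forallP => a.
  case: (unliftP h a) => [a' ->|->]; rewrite ?ext_h ?ext_l //.
  by have := gI a'; rewrite inE => /andP[].
have gq c : q x (g c) by have := gI c; rewrite inE => /andP[].
have hc c : compat t (ext g) h (lift h c) && compat t (ext g) (lift h c) h.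
  by rewrite hq ext_h ext_l.
apply/forallP => b; case: (unliftP h a) => [a' ->|->]; case: (unliftP h b) => [b' ->|->].
- by rewrite (compat_lift _ g) ?ext_l //; have /forallP := gc a'; apply.
- by have /andP[] := hc a'.
- by have /andP[] := hc b'.
by rewrite /compat ltnn.
Qed.

Lemma occ_in_last t m I : (forall a, a < m -> t a < t m) ->
  occ_in t m.+1 I = \sum_(x in I) occ_in t m [set y in I | (y < x) && (s y < s x)].
Proof.
move=> tm; rewrite (@occ_in_pivot _ _ ord_max (fun x y => (y < x) && (s y < s x))).
  apply: eq_bigr => x _; apply: eq_occ_in => a am /=; rewrite /bump leqNgt am //.
move=> f a; rewrite /compat lift_max ltn_ord tm ?ltn_ord // eqb_id.
by rewrite ltnNge (ltnW (ltn_ord a)).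
Qed.

(** [c] is true for a smallest first entry, as in 132, and false for a largest one, as in 21. *)
Lemma occ_in_first t m c I : (forall a, a < m -> (t 0 < t a.+1) = c) ->
  occ_in t m.+1 I = \sum_(x in I) occ_in (t \o succn) m
    [set y in I | (x < y) && ((s x < s y) == c)].
Proof.
move=> tc; rewrite (@occ_in_pivot _ _ ord0 (fun x y => (x < y) && ((s x < s y) == c))) //.
by move=> f a; rewrite /compat lift0 /= andbT tc ?ltn_ord.
Qed.

Definition pts_in (I : {set 'I_n}) := [seq (val x, val (s x)) | x <- enum I].

Lemma filter_pts_in (a : pred (nat * nat)) (I : {set 'I_n}) :
  filter a (pts_in I) = pts_in [set x in I | a (val x, val (s x))].
Proof.
rewrite /pts_in filter_map; congr map; rewrite {2}/enum_mem -filter_predI.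
by apply: eq_filter => x; rewrite /= !inE andbC.
Qed.

Lemma occ_in1 t I : occ_in t 1 I = #|I|.
Proof.
rewrite (@occ_in_first _ _ true) // -sum1_card; apply: eq_bigr => x _.
exact: occ_in0.
Qed.

Lemma occ_in2 t I : t 1 <= t 0 -> occ_in t 2 I = ninv (pts_in I).
Proof.
move=> t10; rewrite (@occ_in_first _ _ false) => [|[] // _]; last by rewrite ltnNge t10.
rewrite /ninv big_map big_enum /=; apply: eq_bigr => x _.
rewrite occ_in1 -size_filter filter_pts_in size_map -cardE.
apply: eq_card => y; rewrite !inE /nw /= eqbF_neg -leqNgt; congr (_ && _).
(* The negation of [s x < s y] is not strict; injectivity of [s] excludes equality. *)
case: ltngtP => //= xy; rewrite leq_eqVlt orbC; case: ltngtP => //= e.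
by have /perm_inj exy := val_inj e; rewrite exy ltnn in xy.
Qed.

(** The infinite word 2, 1, 3, 4, ..., of which all the patterns are prefixes. *)
Definition t213 a := if a == 0 then 2 else if a == 1 then 1 else a.+1.

Lemma occ_in213 e I : occ_in t213 e.+2 I = n213 e (pts_in I).
Proof.
elim: e I => [|e IH] I; first exact: occ_in2.
rewrite occ_in_last => [|[|[|a]] //].
rewrite -[RHS]/(\sum_(p <- pts_in I) n213 e (below p (pts_in I))) big_map big_enum /=.
by apply: eq_bigr => x _; rewrite IH /below filter_pts_in.
Qed.

Lemma occ_in132 t I : t 0 < t 1 -> t 0 < t 2 -> t 2 <= t 1 -> occ_in t 3 I = n132 (pts_in I).
Proof.
move=> t01 t02 t21; rewrite (@occ_in_first _ _ true) => [|[|[]] //].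
rewrite /n132 big_map big_enum /=; apply: eq_bigr => x _.
rewrite occ_in2 // /above filter_pts_in; congr (ninv (pts_in _)).
by apply/setP => y; rewrite !inE /sw /= eqb_id.
Qed.

Lemma occE tau : occ tau s = occ_in (nth 0 tau) (size tau) setT.
Proof.
apply: eq_card => f; rewrite !inE /occurrence.
by rewrite (_ : [forall a, f a \in setT] = true) //; apply/forallP => a; rewrite inE.
Qed.

Definition word := [seq val (s x) | x <- enum 'I_n].

Lemma size_word : size word = n.
Proof. by rewrite size_map size_enum_ord. Qed.

Lemma nth_word (x : 'I_n) : nth 0 word x = s x.
Proof. by rewrite (nth_map x) ?size_enum_ord // nth_ord_enum. Qed.

Lemma pts_word : pts word = pts_in setT.
Proof.
rewrite /pts /pts_in size_word -val_enum_ord -map_comp enum_setT enumT.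
by apply: eq_map => x /=; rewrite nth_word.
Qed.

Lemma occ132_word : occ pat132 s = n132 (pts word).
Proof. by rewrite occE pts_word occ_in132. Qed.

Lemma occ2134_word e : occ (pat2134 e.+2) s = n213 e (pts word).
Proof.
rewrite (_ : pat2134 _ = [:: 2, 1 & iota 3 e]) ?/pat2134 ?subSS ?subn0 //.
rewrite occE pts_word -occ_in213 [size _]/= size_iota.
apply: eq_occ_in => -[|[|a]] // ae /=; rewrite nth_iota //; lia.
Qed.

Lemma inversions_word : inversions s = ninv (pts word).
Proof.
rewrite pts_word /inversions /ninv big_map big_enum /= -sum1dep_card.
rewrite -(pair_big_dep xpredT (fun x y : 'I_n => (x < y) && (s y < s x)) (fun _ _ => 1)) /=.
rewrite [RHS]big_mkcond; apply: eq_bigr => x _; rewrite inE sum1dep_card.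
rewrite -size_filter filter_pts_in size_map -cardE.
by apply: eq_card => y; rewrite !inE.
Qed.

Lemma isperm_word : isperm word.
Proof.
apply: uniq_perm; rewrite ?iota_uniq //.
  by rewrite map_inj_uniq ?enum_uniq // => x y /val_inj/perm_inj.
move=> v; rewrite size_word mem_iota /=; apply/mapP/idP => [[x _ ->]|vn]; first exact: ltn_ord.
by exists ((s^-1)%g (Ordinal vn)); rewrite ?mem_enum // permKV.
Qed.

Lemma invol_word : invol word = (s == (s^-1)%g).
Proof.
apply/involP/eqP => [h|h i].
  apply: (mulgI s); rewrite mulgV; apply/perm.permP => x; rewrite permM perm1; apply: val_inj.
  by have := h x; rewrite size_word nth_word nth_word => /(_ (ltn_ord x)).
rewrite size_word => ilt; rewrite -[i]/(val (Ordinal ilt)) !nth_word.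
by rewrite {1}h permK.
Qed.
End Transfer.

Lemma word_inj n : injective (@word n).
Proof.
move=> s s' e; apply/perm.permP => x; apply: val_inj.
by rewrite /= -!nth_word e.
Qed.

Lemma word_surj n w : isperm w -> size w = n -> exists s : 'S_n, w = word s.
Proof.
move=> pw sw; have lt (x : 'I_n) : nth 0 w x < n by rewrite -{2}sw isperm_nth // sw.
have inj : injective (fun x => Ordinal (lt x)).
  by move=> x y [] /(isperm_inj pw) e; apply: val_inj; apply: e; rewrite sw.
exists (perm inj); apply: (@eq_from_nth _ 0) => [|i]; first by rewrite size_word.
by rewrite sw => ilt; rewrite -[i]/(val (Ordinal ilt)) nth_word permE.
Qed.

Lemma Je_words e n : Je (pat2134 e.+3) 1 n =
  size [seq w <- listA e.+1 n | ~~ odd (ninv (pts w))].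
Proof.
rewrite /Je cardE -(size_map (@word n)); apply: perm_size; apply: uniq_perm.
- by rewrite map_inj_uniq ?enum_uniq //; apply: word_inj.
- by rewrite filter_uniq ?listA_uniq.
move=> w; rewrite mem_filter mem_listA inAS; apply/mapP/idP => [[s]|].
  rewrite mem_enum inE => /and4P[s1 s2 s3 s4] ->.
  rewrite invol_word isperm_word size_word -inversions_word -occ132_word -occ2134_word.
  by rewrite s1 s2 s3 s4 eqxx.
move=> /and4P[w1 /and3P[w2 w3 w4] pw /eqP sw].
have [s es] := word_surj pw sw; exists s => //; rewrite mem_enum inE.
by rewrite -invol_word inversions_word occ132_word occ2134_word -es w1 w2 w3 w4.
Qed.

(** Occurrences of 21 are inversions, and 1 is odd. *)
Lemma Je21 n : Je (pat2134 2) 1 n = 0.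
Proof.
apply: eq_card0 => s; rewrite !inE occ2134_word inversions_word.
by apply/negP => /and4P[_ + _ /eqP h]; rewrite -[ninv _]/(n213 0 _) h.
Qed.

(** The lengths are [e + 4 + 2 m], and [m] is odd exactly for the even involutions, whence the
    residue 2 modulo 4. *)
Lemma Je_parity e n : Je (pat2134 e.+3) 1 n =
  if (e + 4 <= n) && ((n - (e + 4)) %% 4 == 2) then size (listA e.+1 n) else 0.
Proof.
rewrite Je_words; case: ifP => h.
  congr size; apply/all_filterP/allP => w /listA_parity[m [em ->]].
  by rewrite negbK; lia.
apply/eqP; rewrite size_eq0; apply/eqP/filter_in0 => w /listA_parity[m [em ->]].
by rewrite negbK; lia.
Qed.

(** * Generating functions *)

Lemma size_listC_0 e : size (listC e 0) = 1.
Proof.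
suff /perm_size : perm_eq (listC e 0) [:: [::]] by [].
apply: uniq_perm; rewrite ?listC_uniq // => w; rewrite inE mem_listC.
apply/and3P/eqP => [[_ _ /nilP //]|->]; split=> //.
by rewrite /inC /n132 big_nil; case: e => [|e]; rewrite /n213 /ninv big_nil.
Qed.

Lemma size_listA0 n : size (listA 0 n) = (n == 3).
Proof.
case: eqP => [->|n3].
  suff /perm_size : perm_eq (listA 0 3) [:: [:: 0; 2; 1]] by [].
  apply: uniq_perm; rewrite ?listA_uniq // => w; rewrite inE mem_listA.
  apply/and3P/eqP => [[+ pw _]|->]; first by rewrite listA0 // => /eqP.
  by rewrite listA0.
apply/eqP; rewrite size_eq0; apply/eqP/filter_in0 => w.
rewrite mem_permutations ispermE => /andP[pw /eqP sw]; rewrite listA0 //.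
by apply: contra_not_neq n3 => e; rewrite -sw e.
Qed.

Definition cntC e n := size (listC e n).
Definition cntA e m := size (listA e (e + 3 + m.*2)).

(** For [j] at least [m] the middle block would be shorter than [e + 4], its least possible length,
    so the sum over the positions of the maximum stops at [m]. *)
Lemma cntAS e m : cntA e.+1 m = cntA e m + \sum_(j < m) cntC e j * cntA e.+1 (m.-1 - j).
Proof.
rewrite /cntA !addSn size_listAS; congr (_ + _); move NE : (e + 3 + m.*2) => N.
have mN : m <= N by lia.
rewrite (big_ord_widen N (fun j => size (listC e j) * size (listA e.+1 (e + 3 + (m.-1 - j).*2).+1)) mN).
rewrite big_mkcond [RHS]big_mkcond; apply: eq_bigr => -[j jN] _ /=.
case: (ltnP j m) => jm.
  have -> : j.*2 < N by lia.
  by congr (_ * size (listA _ _)); lia.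
case: ifP => // _; apply/eqP; rewrite muln_eq0 size_eq0; apply/orP; right.
apply/eqP; case E : (listA _ _) => [//|w t].
have /listA_parity[m' [em _]] : w \in listA e.+1 (N - j.*2.+1) by rewrite E mem_head.
by lia.
Qed.

Import GRing.Theory Num.Theory.
Local Open Scope ring_scope.

(* [(pp r).[x ^+ 2] = x ^+ r * U_r(1 / (2 * x))] *)
Fixpoint pp (r : nat) : {poly algC} :=
  if r is r1.+1 then if r1 is r2.+1 then pp r1 - 'X * pp r2 else 1 else 1.

Lemma pp_rec r : pp r.+2 = pp r.+1 - 'X * pp r.
Proof. by []. Qed.

(** Power series are represented by truncations, compared modulo [X^N]. *)
Definition congX (N : nat) (p q : {poly algC}) := exists r, p = q + 'X^N * r.

Lemma congX_of_coef N (p q : {poly algC}) : (forall i, (i < N)%N -> p`_i = q`_i) -> congX N p q.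
Proof.
move=> h; exists (drop_poly N (p - q)); rewrite mulrC.
have := poly_take_drop N (p - q).
rewrite (_ : take_poly N (p - q) = 0) ?add0r => [->|]; first by rewrite addrC subrK.
apply/polyP => i; rewrite coef_take_poly coef0; case: ltnP => // iN.
by rewrite coefB h ?subrr.
Qed.

Lemma congX_coef N (p q : {poly algC}) i : congX N p q -> (i < N)%N -> p`_i = q`_i.
Proof. by move=> [r ->] iN; rewrite coefD coefXnM iN addr0. Qed.

Section Series.
Variable N : nat.

Definition serC e : {poly algC} := \poly_(i < N) (cntC e i)%:R.
Definition serA e : {poly algC} := \poly_(i < N) (cntA e i)%:R.

Lemma serC0_rec : congX N (serC 0) (1 + 'X * serC 0).
Proof.
apply: congX_of_coef => -[|i] iN; rewrite coefD coefXM coef1 !coef_poly iN /cntC !size_listC0.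
  by rewrite addr0.
by rewrite add0r ltnW.
Qed.

Lemma serCS_rec e : congX N (serC e.+1) (1 + 'X * (serC e * serC e.+1)).
Proof.
apply: congX_of_coef => -[|i] iN; rewrite coefD coefXM coef1 coef_poly iN /cntC.
  by rewrite size_listC_0 addr0.
rewrite add0r size_listCS natr_sum coefM; apply: eq_bigr => j _.
have ji := ltn_ord j.
rewrite natrM !coef_poly (leq_ltn_trans _ (ltnW iN)) ?(leq_ltn_trans _ (ltnW iN)) //.
  exact: leq_subr.
Qed.

Lemma serA0 : congX N (serA 0) 1.
Proof.
apply: congX_of_coef => i iN; rewrite coef1 coef_poly iN /cntA size_listA0.
by case: i iN => [|i] iN //; rewrite (_ : (_ == 3)%N = false) //; lia.
Qed.

Lemma serAS_rec e : congX N (serA e.+1) (serA e + 'X * (serC e * serA e.+1)).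
Proof.
apply: congX_of_coef => i iN; rewrite coefD coefXM !coef_poly iN cntAS natrD; congr (_ + _).
case: i iN => [|i] iN /=; first by rewrite big_ord0.
rewrite natr_sum coefM; apply: eq_bigr => j _; have ji := ltn_ord j.
rewrite natrM !coef_poly (leq_ltn_trans _ (ltnW iN)) ?(leq_ltn_trans _ (ltnW iN)) //.
exact: leq_subr.
Qed.

(** That is, [C_e = P_(e+1) / P_(e+2)]: multiply [C_(e+1) (1 - X C_e) = 1] by [P_(e+2)]. *)
Lemma serC_pp e : congX N (serC e * pp e.+2) (pp e.+1).
Proof.
elim: e => [|e [r2 h2]].
  have [r h] := serC0_rec; exists r; rewrite /= mulr1 mulrBr mulr1 {1}h; ring.
have [r1 h1] := serCS_rec e.
exists ('X * serC e.+1 * r2 + r1 * pp e.+2).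
rewrite pp_rec mulrBr {1}h1.
have -> : (1 + 'X * (serC e * serC e.+1) + 'X^N * r1) * pp e.+2 =
  pp e.+2 + 'X * serC e.+1 * (serC e * pp e.+2) + 'X^N * r1 * pp e.+2 by ring.
rewrite h2; ring.
Qed.

(** Multiplying [A_(e+1) (1 - X C_e) = A_e] by [P_(e+2)] shows that [A_e P_(e+2)] is the same for
    all [e]; for [e = 0] it is [P_2 = 1 - X]. *)
Lemma serA_pp e : congX N (serA e * pp e.+2) (1 - 'X).
Proof.
elim: e => [|e [r3 h3]].
  have [r h] := serA0; exists (r * (1 - 'X)); rewrite /= mulr1 h; ring.
have [r1 h1] := serAS_rec e; have [r2 h2] := serC_pp e.
exists (r3 + 'X * serA e.+1 * r2 + r1 * pp e.+2).
rewrite pp_rec mulrBr {1}h1.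
have -> : (serA e + 'X * (serC e * serA e.+1) + 'X^N * r1) * pp e.+2 =
  serA e * pp e.+2 + 'X * serA e.+1 * (serC e * pp e.+2) + 'X^N * r1 * pp e.+2 by ring.
rewrite h2 h3; ring.
Qed.
End Series.

Lemma coef_comp_polyNX (p : {poly algC}) i : (p \Po (- 'X))`_i = (-1) ^+ i * p`_i.
Proof.
elim/poly_ind: p i => [|p c IH] i; first by rewrite comp_poly0 coef0 mulr0.
rewrite comp_poly_MXaddC mulrN !coefD coefN !coefMX !coefC.
by case: i => [|i] /=; rewrite ?IH ?exprS; ring.
Qed.

(** * The rational function *)

Lemma comp_polyNX2 (p : {poly algC}) : p \Po (- 'X^2) = (p \Po (- 'X)) \Po 'X^2.
Proof. by rewrite -comp_polyA rmorphN /= comp_polyX. Qed.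

(** Coefficient [m] of [A_(e+1)] belongs to length [e + 4 + 2 m]; half the difference of the values
    at [X^2] and [-X^2] selects the odd [m], that is, the even involutions. *)
Lemma Je_coef e N : congX N (\poly_(i < N) (Je (pat2134 e.+3) 1 i)%:R)
  (2^-1 *: ('X^(e + 4) * ((serA N e.+1 \Po 'X^2) - (serA N e.+1 \Po (- 'X^2))))).
Proof.
apply: congX_of_coef => i iN; rewrite coef_poly iN coefZ coefXnM Je_parity.
case: ltnP => ie /=; first by rewrite mulr0.
set t := (i - (e + 4))%N; have et : i = (e + 4 + t)%N by rewrite /t subnKC.
rewrite comp_polyNX2 coefB !coef_comp_poly_Xn // coef_comp_polyNX coef_poly.
have tN : (t %/ 2 < N)%N by lia.
rewrite tN dvdn2 -signr_odd.
case: (boolP (t %% 4 == 2)%N) => t4.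
  rewrite (_ : odd t = false) /=; last by lia.
  rewrite (_ : odd (t %/ 2) = true) /=; last by lia.
  rewrite (_ : size _ = cntA e.+1 (t %/ 2)); first by field.
  by rewrite /cntA et; congr (size (listA _ _)); lia.
case: (boolP (odd t)) => h /=; first by rewrite subrr mulr0.
by rewrite (_ : odd (t %/ 2) = false) ?mul1r ?subrr ?mulr0 //=; lia.
Qed.

(** Common denominator of [A_(e+1)(y) = (1 - y) / P_(e+3)(y)] at [y = X^2] and [y = -X^2]. *)
Definition gf_den e : {poly algC} := (pp e.+3 \Po 'X^2) * (pp e.+3 \Po (- 'X^2)).

Definition gf_num e : {poly algC} := 2^-1 *: ('X^(e + 4) *
  ((1 - 'X^2) * (pp e.+3 \Po (- 'X^2)) - (1 + 'X^2) * (pp e.+3 \Po 'X^2))).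

Lemma Je_gf e n :
  \sum_(i < n.+1) (Je (pat2134 e.+3) 1 i)%:R * (gf_den e)`_(n - i) = (gf_num e)`_n.
Proof.
have [r hr] := Je_coef e n.+1; have [q hq] := serA_pp n.+1 e.+1.
transitivity ((\poly_(i < n.+1) (Je (pat2134 e.+3) 1 i)%:R * gf_den e)`_n).
  by rewrite coefM; apply: eq_bigr => i _; rewrite coef_poly ltn_ord.
apply: (@congX_coef n.+1); last exact: ltnSn.
have hp f : (serA n.+1 e.+1 \Po f) * (pp e.+3 \Po f) = 1 - f + f ^+ n.+1 * (q \Po f).
  by rewrite -rmorphM /= hq !rmorphD rmorphN !rmorphM /= rmorphXn /= comp_polyX rmorph1.
(* Substituting [X^2] or [-X^2] for [X] turns the error terms into multiples of [X^(2n+2)]; one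
   factor [X^(n+1)] of these stays in the witness. *)
exists (2^-1 *: ('X^(e + 4) * 'X^(n.+1) *
   ((q \Po 'X^2) * (pp e.+3 \Po (- 'X^2)) - (-1) ^+ n.+1 * (q \Po (- 'X^2)) * (pp e.+3 \Po 'X^2)))
   + r * gf_den e).
rewrite hr /gf_num /gf_den -!mul_polyC.
set c := _%:P; set s := 'X^(e + 4).
set A := serA _ _ \Po 'X^2 in hp *; set B := serA _ _ \Po (- 'X^2) in hp *.
have h1 := hp 'X^2; have h2 := hp (- 'X^2); rewrite -/A in h1; rewrite -/B in h2.
set p1 := pp _ \Po 'X^2 in h1 *; set p2 := pp _ \Po (- 'X^2) in h2 *.
have hz : 'X^2 ^+ n.+1 = 'X^(n.+1) ^+ 2 :> {poly algC} by rewrite exprAC.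
rewrite exprNn hz in h2; rewrite hz in h1.
move: ('X^(n.+1)) ((-1) ^+ n.+1) (q \Po _) (q \Po _) h1 h2 => z d q1 q2 h1 h2.
have -> : (c * (s * (A - B)) + z * r) * (p1 * p2) =
  c * s * ((A * p1) * p2 - (B * p2) * p1) + z * r * (p1 * p2) by ring.
rewrite h1 h2; ring.
Qed.

Lemma pp_at0 r : (pp r).[0] = 1.
Proof.
suff: (pp r).[0] = 1 /\ (pp r.+1).[0] = 1 by case.
elim: r => [|r [IH0 IH1]]; first by rewrite /= !hornerC.
by split=> //; rewrite pp_rec hornerD hornerN hornerM hornerX IH1 mul0r subr0.
Qed.

Lemma pp_comp_at0 r (q : {poly algC}) : q.[0] = 0 -> (pp r \Po q).[0] = 1.
Proof. by move=> q0; rewrite horner_comp q0 pp_at0. Qed.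

(** * Chebyshev values and the field identities of the telescoping sum *)

Section Field.
Variable L : fieldType.
Implicit Types (s : L) (q : nat -> L).

(** The sequence [s^r U_r(1/(2s))] obeys the recursion of [q]. Leaving [q] abstract serves both
    roots, [x] and [i x]. *)
Lemma chebU_scale s q : 2 != 0 :> L -> s != 0 -> q 0%N = 1 -> q 1%N = 1 ->
  (forall r, q r.+2 = q r.+1 - s ^+ 2 * q r) ->
  forall r, (chebU L r).[1 / (2 * s)] = q r / s ^+ r.
Proof.
move=> n2 ns q0 q1 qS r.
suff: (chebU L r).[1 / (2 * s)] = q r / s ^+ r /\
   (chebU L r.+1).[1 / (2 * s)] = q r.+1 / s ^+ r.+1 by case.
elim: r => [|r [IH0 IH1]].
  by rewrite /= hornerC hornerZ hornerX q0 q1 expr0 expr1; split; field; rewrite ?oner_neq0 ?ns ?n2.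
split=> //; rewrite chebU_rec IH0 IH1 qS !exprS.
by field; rewrite ?n2 ?ns expf_neq0.
Qed.

Lemma ratR_ratio s q r : 2 != 0 :> L -> s != 0 -> q 0%N = 1 -> q 1%N = 1 ->
  (forall r, q r.+2 = q r.+1 - s ^+ 2 * q r) -> (0 < r)%N -> q r != 0 ->
  ratR r (s ^+ 2) = q r.-1 / q r.
Proof.
move=> n2 ns q0 q1 qS; case: r => // r _ nq.
rewrite ratR_sqr // [r.+1.-1]/= !(chebU_scale n2 ns q0 q1 qS) exprS.
by field; rewrite ?nq ?ns expf_neq0.
Qed.

Lemma mulf_div_cancel (a b c : L) : b != 0 -> a / b * (b / c) = a / c.
Proof. by move=> nb; rewrite mulrA divfK. Qed.

(** The summand is a difference because [(v' + y v) u' - v' (u' - y u) = y (u v' + u' v)]. Here [u],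
    [u'] and [v], [v'] stand for consecutive [P_j] at [y] and at [-y], with [y = x^2]; [w] stands
    for [P_k(-y)], and [A], [B], [C] for powers of [x]. *)
Lemma gf_term_identity (A B C y u u' v v' w : L) : 2 != 0 :> L ->
  u' != 0 -> u' - y * u != 0 -> v' != 0 -> w != 0 -> A * B = y * C ->
  A * (1 / 2 * (u / u' + v / v')) * (v' / w) * (B / (u' - y * u)) =
  C / (2 * w) * ((v' + y * v) / (u' - y * u) - v' / u').
Proof.
move=> n2 nu' nu nv' nw eC.
have -> : A * (1 / 2 * (u / u' + v / v')) * (v' / w) * (B / (u' - y * u)) =
  A * B * (1 / 2 * (u / u' + v / v') * (v' / w) / (u' - y * u)).
  by field; rewrite ?n2 ?nu' ?nu ?nv' ?nw.
by rewrite eC; field; rewrite ?n2 ?nu' ?nu ?nv' ?nw.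
Qed.

(** The quotient [(1 + y) / (1 - y)] is the lower end [P_2(-y) / P_2(y)] of the telescoping sum. *)
Lemma gf_sum_identity (C y u v : L) : 2 != 0 :> L -> u != 0 -> v != 0 -> 1 - y != 0 ->
  (1 - y) * (C / (2 * v) * (v / u - (1 + y) / (1 - y))) =
  C / 2 * ((1 - y) / u - (1 + y) / v).
Proof. by move=> n2 nu nv ny; field; rewrite ?n2 ?nu ?nv ?ny. Qed.

Lemma gf_quotient_identity (C y u v : L) : 2 != 0 :> L -> u != 0 -> v != 0 ->
  C / 2 * ((1 - y) / u - (1 + y) / v) =
  2^-1 * (C * ((1 - y) * v - (1 + y) * u)) / (u * v).
Proof. by move=> n2 nu nv; field; rewrite ?n2 ?nu ?nv. Qed.
End Field.

(** * Evaluation in the field of rational functions *)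

Definition ppx r : ratfun := tofrac (pp r \Po 'X^2).
Definition ppnx r : ratfun := tofrac (pp r \Po (- 'X^2)).

Lemma tofrac_comp_rec (q : {poly algC}) r :
  tofrac (pp r.+2 \Po q) = tofrac (pp r.+1 \Po q) - tofrac q * tofrac (pp r \Po q) :> ratfun.
Proof. by rewrite pp_rec rmorphB rmorphM /= comp_polyX rmorphB rmorphM. Qed.

Lemma ppx_rec r : ppx r.+2 = ppx r.+1 - xvar ^+ 2 * ppx r.
Proof. by rewrite /ppx tofrac_comp_rec /xvar rmorphXn. Qed.

Lemma ppnx_rec r : ppnx r.+2 = ppnx r.+1 + xvar ^+ 2 * ppnx r.
Proof. by rewrite /ppnx tofrac_comp_rec /xvar !rmorphN rmorphXn /= mulNr opprK. Qed.

Lemma tofrac_comp_neq0 r (q : {poly algC}) : q.[0] = 0 -> tofrac (pp r \Po q) != 0 :> ratfun.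
Proof.
move=> q0; rewrite tofrac_eq0; apply: contraTneq isT => e.
by have := pp_comp_at0 r q0; rewrite e horner0 => /eqP; rewrite eq_sym oner_eq0.
Qed.

Lemma ppx_neq0 r : ppx r != 0.
Proof. by apply: tofrac_comp_neq0; rewrite hornerXn expr0n. Qed.

Lemma ppnx_neq0 r : ppnx r != 0.
Proof. by apply: tofrac_comp_neq0; rewrite hornerN hornerXn expr0n oppr0. Qed.

Lemma ppx0 : ppx 0 = 1. Proof. by rewrite /ppx /= rmorph1 rmorph1. Qed.
Lemma ppx1 : ppx 1 = 1. Proof. exact: ppx0. Qed.
Lemma ppnx0 : ppnx 0 = 1. Proof. by rewrite /ppnx /= rmorph1 rmorph1. Qed.
Lemma ppnx1 : ppnx 1 = 1. Proof. exact: ppnx0. Qed.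

Lemma xvar_neq0 : xvar != 0.
Proof. by rewrite tofrac_eq0 polyX_eq0. Qed.

Lemma tofrac_2 : (2 : ratfun) = tofrac (2%:R : {poly algC}).
Proof. by rewrite [RHS]tofracMn; congr (_ *+ 2); rewrite tofrac1. Qed.

Lemma two_neq0 : 2 != 0 :> ratfun.
Proof.
by rewrite tofrac_2 tofrac_eq0 -polyC_natr polyC_eq0 pnatr_eq0.
Qed.

Lemma ratR_ppx r : (0 < r)%N -> ratR r (xvar ^+ 2) = ppx r.-1 / ppx r.
Proof.
move=> r0.
exact: ratR_ratio two_neq0 xvar_neq0 ppx0 ppx1 ppx_rec r0 (ppx_neq0 r).
Qed.

Lemma ratR_ppnx r : (0 < r)%N -> ratR r (- xvar ^+ 2) = ppnx r.-1 / ppnx r.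
Proof.
(* The square root of [-x^2] is [i x], and [P_r(-x^2)] satisfies the recursion for that root. *)
move=> r0; pose s := tofrac 'i%:P * xvar : ratfun.
have ei : tofrac 'i%:P ^+ 2 = -1 :> ratfun.
  by rewrite -tofracXn -polyC_exp sqrCi polyCN tofracN polyC1 tofrac1.
have es : - xvar ^+ 2 = s ^+ 2 by rewrite /s exprMn ei mulN1r.
have ns : s != 0 by rewrite -sqrf_eq0 -es oppr_eq0 expf_neq0 ?xvar_neq0.
have rec i : ppnx i.+2 = ppnx i.+1 - s ^+ 2 * ppnx i by rewrite ppnx_rec -es mulNr opprK.
rewrite es; exact: ratR_ratio two_neq0 ns ppnx0 ppnx1 rec r0 (ppnx_neq0 r).
Qed.

Lemma cheb_ppx r : (chebU ratfun r).[1 / (2 * xvar)] = ppx r / xvar ^+ r.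
Proof. exact: chebU_scale two_neq0 xvar_neq0 ppx0 ppx1 ppx_rec r. Qed.

Lemma prod_ratR_ppnx j k : (j <= k)%N ->
  \prod_(j.+1 <= i < k.+1) ratR i (- xvar ^+ 2) = ppnx j / ppnx k.
Proof.
move/subnKC <-; elim: (k - j)%N => [|d IH].
  by rewrite addn0 big_geq ?divff ?ppnx_neq0.
rewrite addnS big_nat_recr ?ltnS ?leq_addr //= IH ratR_ppnx //=.
exact: mulf_div_cancel (ppnx_neq0 _).
Qed.

(** The powers [x^(k+2-j)] and, from the Chebyshev polynomial, [x^(j+1)] combine to [x^2 x^(k+1)],
    so that [j] disappears from the prefactor. *)
Lemma gf_term k j : (2 <= j < k)%N ->
  xvar ^+ (k + 2 - j) * ratRe j (xvar ^+ 2) *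
    (\prod_(j.+1 <= i < k.+1) ratR i (- xvar ^+ 2)) / (chebU _ j.+1).[1 / (2 * xvar)] =
  xvar ^+ k.+1 / (2 * ppnx k) * (ppnx j.+1 / ppx j.+1 - ppnx j / ppx j).
Proof.
case: j => [//|j] /andP[_ jk].
rewrite /ratRe ratR_ppx // ratR_ppnx // prod_ratR_ppnx ?(ltnW jk) // cheb_ppx invf_div.
rewrite ppx_rec ppnx_rec [j.+1.-1]/=.
have nu := ppx_neq0 j.+2; rewrite ppx_rec in nu.
apply: gf_term_identity two_neq0 (ppx_neq0 _) nu (ppnx_neq0 _) (ppnx_neq0 _) _.
by rewrite -!exprD; congr (_ ^+ _); lia.
Qed.

Lemma gf_sum k : (2 <= k)%N -> (1 - xvar ^+ 2) *
     \sum_(2 <= j < k)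
       (xvar ^+ (k + 2 - j) * ratRe j (xvar ^+ 2) *
          \prod_(j.+1 <= i < k.+1) ratR i (- xvar ^+ 2)) /
       (chebU _ j.+1).[1 / (2 * xvar)] =
  xvar ^+ k.+1 / 2 * ((1 - xvar ^+ 2) / ppx k - (1 + xvar ^+ 2) / ppnx k).
Proof.
move=> k2; rewrite (eq_big_nat _ _ (@gf_term k)) -big_distrr /=.
rewrite (telescope_sumr (fun j => ppnx j / ppx j)) //.
have := ppx_neq0 2; rewrite ppx_rec ppnx_rec ppx1 ppx0 ppnx1 ppnx0 !mulr1 => nu2.
exact: gf_sum_identity two_neq0 (ppx_neq0 k) (ppnx_neq0 k) nu2.
Qed.

Lemma tofrac_half : tofrac (2^-1)%:P = 2^-1 :> ratfun.
Proof.
apply: (mulfI two_neq0); rewrite divff ?two_neq0 //.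
by rewrite tofrac_2 -tofracM -polyC_natr -polyCM divff ?pnatr_eq0 // polyC1 tofrac1.
Qed.

Lemma tofrac_gf_num e : tofrac (gf_num e) =
  2^-1 * (xvar ^+ e.+4 * ((1 - xvar ^+ 2) * ppnx e.+3 - (1 + xvar ^+ 2) * ppx e.+3)) :> ratfun.
Proof.
rewrite /gf_num -mul_polyC addn4 /xvar -!tofracXn -!tofrac1.
by rewrite !(tofracM, tofracB, tofracD) tofrac_half.
Qed.

Theorem theorem3p26 (k : nat) (hk : (2 <= k)%N) :
  gf_eq (fun n => Je (pat2134 k) 1 n)
    ((1 - xvar ^+ 2) *
     \sum_(2 <= j < k)
       (xvar ^+ (k + 2 - j) * ratRe j (xvar ^+ 2) *
          \prod_(j.+1 <= i < k.+1) ratR i (- xvar ^+ 2)) /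
       (chebU _ j.+1).[1 / (2 * xvar)]).
Proof.
case: k hk => [|[|[|e]]] // _.
  (* For [k = 2] the sum is empty, and no even permutation has exactly one inversion. *)
  exists 0, 1; split; first by rewrite coef1 oner_neq0.
    by rewrite big_geq // mulr0 rmorph0 mul0r.
  by move=> n; rewrite coef0 big1 // => i _; rewrite Je21 mul0r.
(* Here [k = e + 3]; both factors of the denominator have constant term 1. *)
exists (gf_num e), (gf_den e); split; last exact: Je_gf.
  by rewrite -horner_coef0 hornerM !pp_comp_at0 ?mul1r ?oner_neq0 // ?hornerN hornerXn expr0n ?oppr0.
rewrite gf_sum // tofrac_gf_num /gf_den tofracM.
exact: gf_quotient_identity two_neq0 (ppx_neq0 _) (ppnx_neq0 _).
Qed.
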